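(* Let $X$ be a biconnected graph on $n \geq 3$ vertices which has an open ear decomposition with at most one ear, and let $Y$ be a simple graph on $n$ vertices such that $\overline{Y}$ is a forest with trees $\mathcal T_1,\dots,\mathcal T_r$ satisfying $\gcd(|V(\mathcal T_1)|,\dots,|V(\mathcal T_r)|) = 1$. Then $\mathsf{FS}(X,Y)$ is connected.
   Context: For simple graphs $X,Y$ on the same number of vertices, $\mathsf{FS}(X,Y)$ has as vertices all bijections $\sigma: V(X)\to V(Y)$, with $\sigma,\sigma'$ adjacent iff there is an edge $\{a,b\}\in E(X)$ with $\{\sigma(a),\sigma(b)\}\in E(Y)$, $\sigma'(a)=\sigma(b)$, $\sigma'(b)=\sigma(a)$ and $\sigma'=\sigma$ elsewhere. An open ear decomposition of $G$ is a sequence of subgraphs $[P_0,\dots,P_r]$ whose edge sets partition $E(G)$, where $P_0$ is a simple cycle and each $P_i$ ($i\ge1$) is a path with distinct endpoints lying in $P_0\cup\dots\cup P_{i-1}$ and internal vertices lying in none of them; $r$ is the number of ears. *)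

(* Defs.v *)
From mathcomp Require Import all_boot.

Set Implicit Arguments.
Unset Strict Implicit.
Unset Printing Implicit Defensive.

Record sgraph := SGraph {
  vertex :> finType;
  edge : rel vertex;
  edge_sym : symmetric edge;
  edge_irrefl : irreflexive edge }.

Definition compl_edge (G : sgraph) : rel G := fun x y => (x != y) && ~~ edge x y.

Lemma compl_edge_sym (G : sgraph) : symmetric (@compl_edge G).
Proof. by move=> x y; rewrite /compl_edge eq_sym edge_sym. Qed.

Lemma compl_edge_irrefl (G : sgraph) : irreflexive (@compl_edge G).
Proof. by move=> x; rewrite /compl_edge eqxx. Qed.

Definition compl (G : sgraph) : sgraph :=
  SGraph (@compl_edge_sym G) (@compl_edge_irrefl G).

Definition del_vertex_edge (G : sgraph) (v : G) : rel {x : G | x != v} :=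
  fun x y => edge (val x) (val y).

Lemma del_vertex_edge_sym (G : sgraph) (v : G) : symmetric (@del_vertex_edge G v).
Proof. by move=> x y; apply: edge_sym. Qed.

Lemma del_vertex_edge_irrefl (G : sgraph) (v : G) :
  irreflexive (@del_vertex_edge G v).
Proof. by move=> x; apply: edge_irrefl. Qed.

Definition del_vertex (G : sgraph) (v : G) : sgraph :=
  SGraph (@del_vertex_edge_sym G v) (@del_vertex_edge_irrefl G v).

Definition connected (G : sgraph) : Prop :=
  0 < #|G| /\ forall x y : G, connect (@edge G) x y.

Definition biconnected (G : sgraph) : Prop :=
  connected G /\ forall v : G, connected (del_vertex v).

Definition components (G : sgraph) : {set {set G}} :=
  equivalence_partition (connect (@edge G)) [set: G].

(* [mathcomp.path.ucycle] alone also accepts the closed walks [::] and         *)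
(* [:: x; y] (along an edge back and forth), whence the size condition.        *)
Definition is_simple_cycle (G : sgraph) (c : seq G) : bool :=
  [&& 2 < size c, cycle (@edge G) c & uniq c].

Definition forest (G : sgraph) : Prop :=
  forall c : seq G, ~~ is_simple_cycle c.

Definition edge_set (G : sgraph) : {set {set G}} :=
  [set [set u.1; u.2] | u : G * G & edge u.1 u.2].

Definition path_edges (G : sgraph) (p : seq G) : {set {set G}} :=
  [set [set u.1; u.2] | u in zip p (behead p)].

Definition cycle_edges (G : sgraph) (c : seq G) : {set {set G}} :=
  [set [set u.1; u.2] | u in zip c (rot 1 c)].

(* [p] lists the vertices of a path with at least one edge, whose endpoints    *)
(* lie in [V] and whose internal vertices do not.                              *)
Definition is_open_ear (G : sgraph) (V p : seq G) : bool :=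
  if p is x :: q then
    [&& path (@edge G) x q, uniq (x :: q), q != [::],
        x \in V, last x q \in V
      & all (fun z => z \notin V) (behead (belast x q))]
  else false.

(* The subgraphs P_0 and P_1, ..., P_r are given by the vertex sequences [c]   *)
(* and [ears]; thus [r = size ears].                                           *)
Definition open_ear_decomposition (G : sgraph) (c : seq G) (ears : seq (seq G))
    : Prop :=
  let Es := cycle_edges c :: [seq path_edges p | p <- ears] in
  [/\ is_simple_cycle c,
      forall i, i < size ears ->
        is_open_ear (c ++ flatten (take i ears)) (nth [::] ears i),
      pairwise (fun A B : {set {set G}} => [disjoint A & B]) Es
    & \bigcup_(E <- Es) E = edge_set G].

Section FriendsAndStrangers.

Variables X Y : sgraph.

Definition FS_vertex : finType :=
  {s : {ffun X -> Y} | injectiveb s && [forall y, y \in codom s]}.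

Definition FS_edge : rel FS_vertex := fun s s' =>
  [exists a : X, exists b : X,
    [&& edge a b, edge (val s a) (val s b),
        val s' a == val s b, val s' b == val s a
      & [forall c : X, (c != a) && (c != b) ==> (val s' c == val s c)]]].

Lemma FS_edge_sym : symmetric FS_edge.
Proof.
suff sym s s' : FS_edge s s' -> FS_edge s' s.
  by move=> s s'; apply/idP/idP; apply: sym.
case/existsP=> a /existsP[b /and5P[eab esab /eqP s'a /eqP s'b /forallP s'c]].
apply/existsP; exists a; apply/existsP; exists b.
rewrite eab s'a s'b edge_sym esab !eqxx /=.
by apply/forallP=> c; rewrite [val s c == _]eq_sym; apply: s'c.
Qed.

Lemma FS_edge_irrefl : irreflexive FS_edge.
Proof.
move=> s; apply/negbTE/negP; case/existsP=> [a /existsP[b /and5P[_ esab /eqP sab _ _]]].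
by rewrite sab edge_irrefl in esab.
Qed.

Definition FS : sgraph := SGraph FS_edge_sym FS_edge_irrefl.

End FriendsAndStrangers.

(* Main.v *)
(* Both vertex sets are identified, so that an arrangement is a permutation,
   and [F] denotes the forest complementary to [Y]. By leaf induction, any
   two arrangements of people around a cycle of [X] are equivalent up to a
   rotation. Pushing a union [D] of trees of [F] past everybody else rotates
   the cycle by [#|D|], so on a Hamiltonian cycle coprimality makes
   rotations free; likewise on a shorter cycle one of whose people has no
   [F]-neighbour on it. Otherwise [X] contains a spanning theta graph with
   ends [u], [v] and three nonempty rooms (the interiors of its paths). If
   [F] has an isolated vertex, that person is brought to [u], and then all
   three cycles are free. If not, pick leaves [l1], [l2] with neighbours
   [w1], [w2] in different trees. When [wi] is inside a room and [li] is
   outside of it, [li] is isolated on the cycle avoiding that room, which is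
   therefore free. Every arrangement can be brought to one with [l1] at [u],
   [l2] at [v] and [w1], [w2] in different rooms, and all these arrangements
   are equivalent: each [wi] may roam everywhere except in the room of the
   other one. *)
Require Import Defs.
From mathcomp Require Import all_boot fingroup perm.

Set Implicit Arguments.
Unset Strict Implicit.
Unset Printing Implicit Defensive.

(** * Splitting sequences *)

Lemma mem_split (T : eqType) (x : T) c : x \in c -> exists A B, c = A ++ x :: B.
Proof. by case/splitPr=> A B; exists A, B. Qed.

Lemma cat_uniq_inj (T : eqType) (x : T) (s1 s2 t1 t2 : seq T) :
  s1 ++ x :: t1 = s2 ++ x :: t2 -> x \notin s1 -> x \notin s2 ->
  s1 = s2 /\ t1 = t2.
Proof.
elim: s1 s2 => [|y s1 IH] [|z s2] //=.
- by case=> ->.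
- by case=> -> _; rewrite mem_head.
- by case=> -> _; rewrite mem_head.
case=> -> E; rewrite !inE !negb_or => /andP[_ x1] /andP[_ x2].
by have [-> ->] := IH s2 E x1 x2.
Qed.

Lemma map_cat_inv (A B : Type) (f : A -> B) c p x y q :
  map f c = p ++ x :: y :: q ->
  exists c1 a b c2, [/\ c = c1 ++ a :: b :: c2, map f c1 = p, f a = x, f b = y
    & map f c2 = q].
Proof.
elim: p c => [|z p IH] [|a c] //=.
  by case: c => [|b c] //= [<- <- <-]; exists [::], a, b, c.
by case=> <- /IH[c1 [a' [b [c2 [-> <- <- <- <-]]]]];
  exists (a :: c1), a', b, c2.
Qed.

Lemma mem_zip (A B : eqType) (s : seq A) (t : seq B) z :
  z \in zip s t -> (z.1 \in s) && (z.2 \in t).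
Proof.
elim: s t => [|a s IH] [|b t] //=.
rewrite !inE => /orP[/eqP->|/IH/andP[-> ->]]; first by rewrite !eqxx.
by rewrite !orbT.
Qed.

Lemma mem_bigcup_seq (A : finType) (Es : seq {set A}) z :
  z \in \bigcup_(E <- Es) E -> exists2 E, E \in Es & z \in E.
Proof.
elim: Es => [|E Es IH]; first by rewrite big_nil inE.
rewrite big_cons inE => /orP[zE|/IH[F FE zF]].
  by exists E; rewrite ?mem_head.
by exists F; rewrite // inE FE orbT.
Qed.

(** * Arrangements on a path and on a cycle *)

Section Words.

Variables (T : eqType) (fr : rel T).
Hypothesis frC : symmetric fr.

(* [fr x y] means that [x] and [y] may swap places; [lin] and [cyc] relate the
   words read along a path, respectively a cycle, of [X]. *)
Inductive lin : seq T -> seq T -> Prop :=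
| lin_refl s : lin s s
| lin_trans s t r : lin s t -> lin t r -> lin s r
| lin_swap p x y q : fr x y -> lin (p ++ x :: y :: q) (p ++ y :: x :: q).

Inductive cyc : seq T -> seq T -> Prop :=
| cyc_lin s t : lin s t -> cyc s t
| cyc_trans s t r : cyc s t -> cyc t r -> cyc s r
| cyc_rot k s t : cyc s t -> cyc (rot k s) (rot k t).

Lemma lin_sym s t : lin s t -> lin t s.
Proof.
elim=> {s t} [s|s t r _ st _ tr|p x y q xy]; first exact: lin_refl.
  exact: lin_trans tr st.
by apply: lin_swap; rewrite frC.
Qed.

Lemma lin_perm s t : lin s t -> perm_eq s t.
Proof.
elim=> {s t} [s|s t r _ st _ tr|p x y q _] //; first exact: perm_trans tr.
by rewrite perm_cat2l (perm_catCA [:: x] [:: y] q).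
Qed.

Lemma lin_cat p q s t : lin s t -> lin (p ++ s ++ q) (p ++ t ++ q).
Proof.
elim=> {s t} [s|s t r _ st _ tr|p' x y q' xy]; first exact: lin_refl.
  exact: lin_trans st tr.
by rewrite -!catA !(catA p) /=; apply: lin_swap.
Qed.

Lemma lin_block b s : {in b & s, forall x y, fr x y} -> lin (b ++ s) (s ++ b).
Proof.
have lin1 x r : {in r, forall y, fr x y} -> lin (x :: r) (rcons r x).
  elim: r => [|y r IH] fx /=; first exact: lin_refl.
  apply: (@lin_trans _ (y :: x :: r)).
    by apply: (@lin_swap [::]); apply: fx; rewrite mem_head.
  have := @lin_cat [:: y] [::] _ _ (IH _).
  by rewrite !cats0; apply=> z zr; apply: fx; rewrite inE zr orbT.
elim: b => [|x b IH] fb; first by rewrite cats0; apply: lin_refl.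
apply: (@lin_trans _ (x :: s ++ b)).
  have := @lin_cat [:: x] [::] _ _ (IH _).
  by rewrite !cats0; apply=> y z yb zs; apply: fb => //; rewrite inE yb orbT.
have := @lin_cat [::] b _ _ (lin1 x s _).
rewrite /= cat_rcons; apply=> y ys; apply: fb => //; exact: mem_head.
Qed.

Lemma cyc_refl s : cyc s s. Proof. by apply: cyc_lin; apply: lin_refl. Qed.

Lemma cyc_sym s t : cyc s t -> cyc t s.
Proof.
elim=> {s t} [s t /lin_sym|s t r _ st _ tr|k s t _ st].
- exact: cyc_lin.
- exact: cyc_trans tr st.
- exact: cyc_rot.
Qed.

Lemma cyc_perm s t : cyc s t -> perm_eq s t.
Proof.
elim=> {s t} [s t /lin_perm|s t r _ st _ tr|k s t _ st] //.
  exact: perm_trans tr.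
by rewrite perm_rot perm_sym perm_rot perm_sym.
Qed.

(* [rot k] is the identity for [k > size s]; iterating [rot 1] is additive. *)
Definition rotn k (s : seq T) := iter k (rot 1) s.

Lemma rotnD j k s : rotn (j + k) s = rotn j (rotn k s).
Proof. exact: iterD. Qed.

Lemma rotn_rot k s : k <= size s -> rotn k s = rot k s.
Proof.
elim: k => [|k IH] ks; first by rewrite rot0.
by rewrite rotS // -IH 1?ltnW.
Qed.

Lemma rot_rotn k s : exists m, rot k s = rotn m s.
Proof.
have [ks|/ltnW ks] := leqP k (size s); first by exists k; rewrite rotn_rot.
by exists 0; rewrite rot_oversize.
Qed.

Lemma rotn_size k s : rotn (k * size s) s = s.
Proof.
elim: k => //= k IH; rewrite mulSn rotnD IH rotn_rot //; exact: rot_size.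
Qed.

Lemma rotnK k s : exists m, rotn m (rotn k s) = s.
Proof.
case: s => [|x s]; first by exists 0; elim: k => //= k ->.
exists (k * size s); rewrite -rotnD addnC -mulnS; exact: rotn_size.
Qed.

Lemma cyc_rotn k s t : cyc s t -> cyc (rotn k s) (rotn k t).
Proof. by move=> st; elim: k => //= k IH; apply: cyc_rot. Qed.

(** [cyc_rot] only changes the place from which both words are read, so [cyc] still knows who stands
    where; [ceq] forgets the position on the cycle. *)
Definition ceq s t := exists k, cyc s (rotn k t).

Lemma ceq_cyc s t : cyc s t -> ceq s t. Proof. by exists 0. Qed.

Lemma ceq_refl s : ceq s s. Proof. exact/ceq_cyc/cyc_refl. Qed.

Lemma ceq_trans s t r : ceq s t -> ceq t r -> ceq s r.
Proof.
move=> [k st] [j tr]; exists (k + j); rewrite rotnD.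
exact: cyc_trans st (cyc_rotn k tr).
Qed.

Lemma ceq_sym s t : ceq s t -> ceq t s.
Proof.
case=> k st; have [m mK] := rotnK k t; exists m.
by rewrite -{1}mK; apply/cyc_rotn/cyc_sym.
Qed.

Lemma ceq_rot k s : ceq s (rot k s).
Proof.
have [m ->] := rot_rotn k s; apply: ceq_sym; exists m; exact: cyc_refl.
Qed.

(** The block returns to the front one step at a time: once it has let the next person [y] pass, a
    rotation by one yields [b ++ rcons r y]. *)
Lemma cyc_shift k b r : r != [::] -> {in b & r, forall x y, fr x y} ->
  exists2 r', perm_eq r r' & cyc (rotn k (b ++ r)) (b ++ r').
Proof.
elim: k r => [|k IH] r r0 br; first by exists r => //; apply: cyc_refl.
case: r => // y r in r0 br *.
have pr : perm_eq (y :: r) (rcons r y) by rewrite perm_sym perm_rcons.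
have [||r' rr' L] := IH (rcons r y); first by case: (r).
  by move=> x z xb; rewrite mem_rcons; apply: br.
exists r'; first exact: perm_trans rr'.
apply: cyc_trans L; rewrite [rotn k.+1 _]iterSr -/(rotn _ _); apply: cyc_rotn.
rewrite -cats1 catA -[(b ++ r) ++ _](rot_size_cat [:: y]).
apply: (cyc_rot 1 (s := b ++ y :: r) (t := y :: b ++ r)).
have := @lin_cat [::] r (b ++ [:: y]) ([:: y] ++ b).
rewrite /= -!catA => /(_ (lin_block _))/cyc_lin; apply=> x z xb.
by rewrite inE => /eqP->; apply: br; rewrite ?mem_head.
Qed.

(** Around the cycle [s] comes just before [b1 ++ b2] and changes sides with it. The block recedes
    by [size s] places, and [r] keeps its places because [b1] is as long as [s]. *)
Lemma cyc_back b1 b2 r s : size b1 = size s ->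
    {in b1 ++ b2 & s, forall x y, fr x y} ->
  cyc (b1 ++ b2 ++ r ++ s) (b2 ++ s ++ r ++ b1).
Proof.
move=> sz bs.
have -> : b1 ++ b2 ++ r ++ s = rot (size s) (s ++ (b1 ++ b2) ++ r).
  by rewrite rot_size_cat -!catA.
have -> : b2 ++ s ++ r ++ b1 = rot (size s) ((b1 ++ b2) ++ s ++ r).
  by rewrite -sz -catA rot_size_cat -!catA.
apply/cyc_rot/cyc_sym/cyc_lin.
rewrite catA (catA s); exact: (lin_cat [::] r (lin_block bs)).
Qed.

(** * Insertion of a leaf behind its neighbour *)

Section Insertion.

Variables l n : T.

(** Written letter by letter, the insertion distributes over [++]; in a word without repetition [l]
    enters at most once. *)
Definition ins (s : seq T) :=
  flatten [seq if x == n then [:: n; l] else [:: x] | x <- s].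

Lemma ins_cat s t : ins (s ++ t) = ins s ++ ins t.
Proof. by rewrite /ins map_cat flatten_cat. Qed.

Lemma ins_id s : n \notin s -> ins s = s.
Proof.
elim: s => //= x s IH; rewrite inE negb_or eq_sym => /andP[xn ns].
by rewrite /ins /= (negPf xn) /= -/(ins s) IH.
Qed.

(** The insertion turns a rotation into a rotation, by more places when [n] is among the letters
    moved. *)
Lemma ins_rot k s : ceq (ins s) (ins (rot k s)).
Proof.
have -> : ins (rot k s) = rot (size (ins (take k s))) (ins s).
  by rewrite -{3}(cat_take_drop k s) !ins_cat rot_size_cat.
exact: ceq_rot.
Qed.

Lemma ins_rotn k s : ceq (ins s) (ins (rotn k s)).
Proof.
elim: k => [|k IH]; first exact: ceq_refl.
exact: ceq_trans IH (ins_rot _ _).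
Qed.

(** A swap of [n] with [y] becomes the passage of the pair [n], [l] past [y], allowed since [l] may
    swap with everybody but [n]. *)
Lemma lin_ins s t : {in s, forall y, y != n -> fr l y} -> lin s t ->
  lin (ins s) (ins t).
Proof.
move=> fl st; elim: st fl => {s t} [s|s t r st IHs tr IHt|p x y q xy] fl.
- exact: lin_refl.
- apply: lin_trans (IHs fl) (IHt _) => y; rewrite -(perm_mem (lin_perm st)).
  exact: fl.
have fx : x != n -> fr l x by apply: fl; rewrite mem_cat mem_head orbT.
have fy : y != n -> fr l y by apply: fl; rewrite mem_cat !inE eqxx !orbT.
have insE z r : ins (z :: r) = ins [:: z] ++ ins r.
  by rewrite -ins_cat.
rewrite !ins_cat !(insE _ (_ :: _)) !(insE _ q) !(catA (ins [:: _])).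
apply: lin_cat; rewrite /ins /= !cats0.
case: (eqVneq x n) => [xn|/fx lx]; case: (eqVneq y n) => [yn|/fy ly].
- exact: lin_refl.
- apply: lin_block => a b; rewrite !inE => /orP[]/eqP-> /eqP-> //.
  by rewrite -xn.
- apply: lin_block => a b; rewrite !inE => /eqP-> /orP[]/eqP->.
    by rewrite -yn.
  by rewrite frC.
- by apply: lin_block => a b; rewrite !inE => /eqP-> /eqP->.
Qed.

Lemma cyc_ins s t : {in s, forall y, y != n -> fr l y} -> cyc s t ->
  ceq (ins s) (ins t).
Proof.
move=> fl st; elim: st fl => {s t} [s t st|s t r st IHs tr IHt|k s t st IH] fl.
- exact/ceq_cyc/cyc_lin/lin_ins.
- apply: ceq_trans (IHs fl) (IHt _) => y; rewrite -(perm_mem (cyc_perm st)).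
  exact: fl.
apply: ceq_trans (ins_rot k t); apply: ceq_trans (ceq_sym (ins_rot k s)) _.
by apply: IH => y; rewrite -(mem_rot k); apply: fl.
Qed.

Lemma ceq_ins s t : {in s, forall y, y != n -> fr l y} -> ceq s t ->
  ceq (ins s) (ins t).
Proof.
move=> fl [k st]; apply: ceq_trans (ceq_sym (ins_rotn k t)).
exact: cyc_ins st.
Qed.

(** After a rotation [n] comes first; then [l] walks towards the front, past the people between
    them, until it stands right behind [n]. *)
Lemma ceq_to_ins s : uniq s -> l \in s -> n \in s -> l != n ->
    {in s, forall y, y != l -> y != n -> fr l y} ->
  exists2 v, ceq s (ins v) & perm_eq s (l :: v).
Proof.
move=> us ls ns ln fl; have [i s' E] := rot_to ns.
have ms y : (y \in n :: s') = (y \in s) by rewrite -E mem_rot.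
have {}us : uniq (n :: s') by rewrite -E rot_uniq.
have ls' : l \in s' by move: ls; rewrite -ms inE (negPf ln).
case/splitPr: ls' => p q in E us ms *; exists (n :: p ++ q); last first.
  rewrite -(perm_rot i) E perm_sym.
  by rewrite -cat1s -!cat_cons perm_catCA.
apply: ceq_trans (ceq_rot i s) _; rewrite E.
have -> : ins (n :: p ++ q) = [:: n] ++ ([:: l] ++ p) ++ q.
  rewrite -cat1s ins_cat [ins (p ++ q)]ins_id; last first.
    by move: us => /andP[]; rewrite !mem_cat inE !negb_or => /and3P[-> _ ->].
  by rewrite /ins /= eqxx.
have -> : n :: p ++ l :: q = [:: n] ++ (p ++ [:: l]) ++ q.
  by rewrite -catA.
apply/ceq_cyc/cyc_lin/lin_cat/lin_block => y z yp; rewrite inE => /eqP->.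
rewrite frC; apply: fl.
- by rewrite -ms inE mem_cat yp orbT.
- by apply: contraTneq us => yl; rewrite cons_uniq cat_uniq /= -yl yp !andbF.
- by apply: contraTneq us => yn; rewrite cons_uniq mem_cat -yn yp.
Qed.

End Insertion.

(* Leaf induction: a leaf is carried along immediately behind its neighbour. *)
Lemma ceq_perm s t :
    (forall r : seq T, uniq r -> r != [::] ->
       exists2 l, l \in r &
         exists n, {in r, forall y, y != l -> y != n -> fr l y}) ->
  uniq s -> perm_eq s t -> ceq s t.
Proof.
move=> leaf; move: {2}(size s) (leqnn (size s)) => m.
elim: m s t => [|m IH] s t.
  rewrite leqn0 => /nilP-> _; rewrite perm_sym => /perm_nilP->.
  exact: ceq_refl.
move=> sm us st; have [s0|s0] := eqVneq s [::].
  by move: st; rewrite s0; rewrite perm_sym => /perm_nilP->; apply: ceq_refl.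
have [l ls [n0 fn0]] := leaf s us s0.
have [s1|] := leqP (size s) 1.
  case: s s1 ls st {sm us s0 fn0} => [|x []] // _ _.
  by rewrite perm_sym => /perm_small_eq -> //; apply: ceq_refl.
move=> s1.
(* When [n0] is not in [s] or equals [l], any other letter can play the neighbour. *)
have [n [ns ln fn]] : exists n, [/\ n \in s, l != n &
    {in s, forall y, y != l -> y != n -> fr l y}].
  have [/andP[ns ln]|nn] := boolP ((n0 \in s) && (l != n0)).
    by exists n0; split.
  have [n ns] : exists n, n \in rem l s.
    have := size_rem ls; case: (rem l s) => [|n r] sz.
      by case: (s) s1 sz => [|a []].
    by exists n; rewrite mem_head.
  move: ns; rewrite mem_rem_uniq // !inE => /andP[nl ns].
  exists n; split=> //; first by rewrite eq_sym.
  move=> y ys yl _; apply: fn0 => //; apply: contraNneq nn => <-.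
  by rewrite ys eq_sym.
have ut : uniq t by rewrite -(perm_uniq st).
have mt := perm_mem st.
have [v sv pv] := ceq_to_ins us ls ns ln fn.
have [v' tv pv'] : exists2 v, ceq t (ins l n v) & perm_eq t (l :: v).
  apply: ceq_to_ins; rewrite -?mt // => y; rewrite -mt; exact: fn.
apply: ceq_trans sv (ceq_trans _ (ceq_sym tv)).
have uv : uniq (l :: v) by rewrite -(perm_uniq pv).
apply: ceq_ins.
  move=> y yv yn; apply: fn => //; first by rewrite (perm_mem pv) inE yv orbT.
  by apply: contraTneq uv => <-; rewrite /= yv.
apply: IH; first by rewrite -ltnS; move: sm; rewrite (perm_size pv).
  by case/andP: uv.
by rewrite -(perm_cons l) -(permPl pv) (permPl st).
Qed.

(** * Free rotations of a cycle *)

Section Rotations.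

Variable w : seq T.
Hypothesis ceq_w : forall t, perm_eq w t -> ceq w t.

Lemma cyc_rotn_add j k :
  cyc w (rotn j w) -> cyc w (rotn k w) -> cyc w (rotn (j + k) w).
Proof.
move=> wj wk; rewrite rotnD; apply: cyc_trans wj _; exact: cyc_rotn.
Qed.

Lemma cyc_rotn_mul j k : cyc w (rotn k w) -> cyc w (rotn (j * k) w).
Proof.
move=> wk; elim: j => [|j IH]; first exact: cyc_refl.
by rewrite mulSn; apply: cyc_rotn_add.
Qed.

Lemma cyc_rotn_gcd j k :
  cyc w (rotn j w) -> cyc w (rotn k w) -> cyc w (rotn (gcdn j k) w).
Proof.
case: (posnP j) => [->|j0] wj wk; first by rewrite gcd0n.
(* Bezout without subtraction: [u * j = v * k + gcdn j k]. The rotation by [v * k] is then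
   cancelled. *)
have [u v E _] := egcdnP k j0.
have /cyc_sym := cyc_rotn (gcdn j k) (cyc_rotn_mul v wk).
rewrite -rotnD addnC -E; apply: cyc_trans; exact: cyc_rotn_mul.
Qed.

(** Moving [b] past everybody else turns [b ++ r] into [r ++ b], its rotation by [size b]; the
    unknown rotation between [w] and [b ++ r] commutes with this one. *)
Lemma cyc_rotn_block b r : perm_eq w (b ++ r) ->
  {in b & r, forall x y, fr x y} -> cyc w (rotn (size b) w).
Proof.
move=> /ceq_w[k wk] f; apply: (cyc_trans wk).
apply: cyc_trans (_ : cyc _ (rotn k (rotn (size b) (b ++ r)))) _.
  apply: cyc_rotn; rewrite rotn_rot ?size_cat ?leq_addr // rot_size_cat.
  by apply: cyc_lin; apply: lin_block.
by rewrite -rotnD addnC rotnD; apply: cyc_rotn; apply: cyc_sym.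
Qed.

Lemma cyc_of_rot1 t : cyc w (rotn 1 w) -> perm_eq w t -> cyc w t.
Proof.
move=> w1 /ceq_w[k wk]; have [m mK] := rotnK k t.
have := cyc_rotn_mul m w1; rewrite muln1 => wm; apply: cyc_trans wm _.
by rewrite -[t in cyc _ t]mK; apply: cyc_rotn.
Qed.

End Rotations.

End Words.

(** * Legal moves *)

Section Puzzle.

Variables (T : finType) (eX fr : rel T).
Hypothesis frC : symmetric fr.

Implicit Types (s t : {perm T}) (c : seq T).

(* Places and people are both elements of [T]; [s x] is the person at [x]. *)
Definition step s t : bool :=
  [exists a, exists b, [&& eX a b, fr (s a) (s b) & t == (tperm a b * s)%g]].

Definition reach s t := connect step s t.

Lemma step_sym : symmetric step.
Proof.
suff sym s t : step s t -> step t s by move=> s t; apply/idP/idP; apply: sym.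
case/existsP=> a /existsP[b /and3P[ab sab /eqP->]].
apply/existsP; exists a; apply/existsP; exists b.
by rewrite ab !permM tpermL tpermR frC sab mulgA tperm2 mul1g /=.
Qed.

Lemma reach_sym s t : reach s t = reach t s.
Proof. exact: (sym_connect_sym step_sym). Qed.

Lemma reach_trans t s r : reach s t -> reach t r -> reach s r.
Proof. exact: connect_trans. Qed.

Definition eq_off c s t := forall x, x \notin c -> t x = s x.

Lemma swap_edge s c1 a b c2 : uniq (c1 ++ a :: b :: c2) ->
    eX a b -> fr (s a) (s b) ->
  exists t, [/\ reach s t,
    map t (c1 ++ a :: b :: c2) = map s c1 ++ s b :: s a :: map s c2
    & eq_off (c1 ++ a :: b :: c2) s t].
Proof.
move=> uc ab sab; exists (tperm a b * s)%g; split.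
- apply: connect1; apply/existsP; exists a; apply/existsP; exists b.
  by rewrite ab sab eqxx.
- rewrite map_cat /= !permM tpermL tpermR.
  have fix_on r : a \notin r -> b \notin r -> map (tperm a b * s)%g r = map s r.
    move=> ar br; apply/eq_in_map => x xr; rewrite permM tpermD //.
      by apply: contraNneq ar => ->.
    by apply: contraNneq br => ->.
  move: uc; rewrite cat_uniq /= !inE !negb_or.
  case/and3P=> _ /and3P[ac bc _] /andP[/andP[_ ac2] /andP[bc2 _]].
  by rewrite !fix_on.
move=> x; rewrite mem_cat !inE !negb_or permM => /and4P[_ xa xb _].
by rewrite tpermD // eq_sym.
Qed.

Lemma eq_off_trans c s t r : eq_off c s t -> eq_off c t r -> eq_off c s r.
Proof. by move=> st tr x xc; rewrite tr ?st. Qed.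

Lemma reach_lin a c s w : path eX a c -> uniq (a :: c) ->
    lin fr (map s (a :: c)) w ->
  exists t, [/\ reach s t, map t (a :: c) = w & eq_off (a :: c) s t].
Proof.
move=> pc uc; move Ew: (map s _) => w0 L; move: L s Ew.
elim=> {w0 w} [w|w1 w2 w3 _ IH1 _ IH2|p x y q xy] s Ew.
- by exists s; split=> //; apply: connect0.
- have [t [st /IH2[r [tr rw off2]] off1]] := IH1 s Ew.
  exists r; split=> //; first exact: reach_trans tr.
  exact: eq_off_trans off2.
have [c1 [a' [b [c2 [Ec <- sa sb <-]]]]] := map_cat_inv Ew.
rewrite -sa -sb Ec; apply: swap_edge; rewrite -?Ec ?sa ?sb //.
case: c1 Ec => [|a1 c1] [E1 E2]; first by move: pc; rewrite E2 E1 /= => /andP[].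
by move: pc; rewrite E2 cat_path /= => /and4P[].
Qed.

Lemma reach_cyc c s w : path.cycle eX c -> uniq c -> cyc fr (map s c) w ->
  exists t, [/\ reach s t, map t c = w & eq_off c s t].
Proof.
move=> cc uc; move Ew: (map s _) => w0 L; move: L s c cc uc Ew.
elim=> {w0 w} [w1 w2 L|w1 w2 w3 _ IH1 _ IH2|k w1 w2 _ IH] s c cc uc Ew.
- case: c => [|a c] in cc uc Ew *.
    move: L; rewrite -Ew => /lin_perm; rewrite perm_sym => /perm_nilP->.
    by exists s; split=> //; apply: connect0.
  apply: reach_lin; rewrite ?Ew //.
  by move: cc; rewrite /= rcons_path => /andP[].
- have [t [st Et off1]] := IH1 s c cc uc Ew.
  have [r [tr rw off2]] := IH2 t c cc uc Et.
  exists r; split=> //; first exact: reach_trans tr.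
  exact: eq_off_trans off2.
(* [cyc_rot] is matched by reading the same cycle from another place. *)
have [t [st Et off]] : exists t, [/\ reach s t, map t (rotr k c) = w2
    & eq_off (rotr k c) s t].
  by apply: IH; rewrite ?rotr_cycle ?rotr_uniq // map_rotr Ew rotK.
exists t; split=> //; last by move=> x xc; rewrite off // mem_rotr.
by rewrite -{1}(rotrK k c) map_rot Et.
Qed.

(** A person who left [c] would stand, under the second arrangement, at a place off [c], which the
    first arrangement gives to the same person; injectivity forbids this. *)
Lemma perm_map_off c s t : uniq c -> eq_off c s t ->
  perm_eq (map s c) (map t c).
Proof.
move=> uc off; apply: uniq_perm; rewrite ?(map_inj_uniq perm_inj) //.
suff sub s1 t1 : eq_off c s1 t1 -> {subset map s1 c <= map t1 c}.
  by move=> y; apply/idP/idP; apply: sub => // x xc; rewrite off.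
move=> {s t} {}off _ /mapP[x xc ->].
have [yc|yc] := boolP (t1^-1 (s1 x) \in c)%g.
  by apply/mapP; exists (t1^-1 (s1 x))%g; rewrite ?permKV.
have := off _ yc; rewrite permKV => /perm_inj E.
by rewrite -E xc in yc.
Qed.

Lemma reach_off c s t : path.cycle eX c -> uniq c -> eq_off c s t ->
  cyc fr (map s c) (map t c) -> reach s t.
Proof.
move=> cc uc off /(reach_cyc cc uc)[r [sr /eq_in_map Er offr]].
suff -> : t = r by [].
apply/permP=> x; have [xc|xc] := boolP (x \in c); first by rewrite Er.
by rewrite off // offr.
Qed.

(** Acyclicity of the forest in the form used: every nonempty set of people has a member with at
    most one [F]-neighbour in it. *)
Hypothesis leaf : forall r : seq T, uniq r -> r != [::] ->
  exists2 l, l \in r &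
    exists n, {in r, forall y, y != l -> y != n -> fr l y}.

Lemma ceq_map c s w : uniq c -> perm_eq (map s c) w -> ceq fr (map s c) w.
Proof.
move=> uc; apply: ceq_perm => //; rewrite map_inj_uniq //; exact: perm_inj.
Qed.

(* The isolated person walks once around the cycle. *)
Lemma reach_isolated c z s t : path.cycle eX c -> uniq c -> z \in map s c ->
    {in map s c, forall y, y != z -> fr z y} ->
  eq_off c s t -> reach s t.
Proof.
move=> cc uc zc fz off; apply: (reach_off cc uc off).
apply: cyc_of_rot1 (perm_map_off uc off).
  by move=> r; apply: ceq_map.
have [i r E] := rot_to zc.
have ur : uniq (z :: r) by rewrite -E rot_uniq map_inj_uniq //; apply: perm_inj.
have L : cyc fr (z :: r) (rot 1 (z :: r)).
  apply: cyc_lin; rewrite rot1_cons -cats1; apply: (@lin_block _ _ [:: z]).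
  move=> x y; rewrite inE => /eqP-> yr; apply: fz.
    by rewrite -(mem_rot i) E inE yr orbT.
  by apply: contraTneq ur => <-; rewrite /= yr.
have E1 : rot 1 (map s c) = rotr i (rot 1 (z :: r)) by rewrite -E rot_rot rotK.
rewrite /rotn /= E1 -{1}(rotK i (map s c)) E /rotr size_rot; exact: cyc_rot.
Qed.

(** The sets [D] are the unions of trees of [F], so this is coprimality of the tree sizes without
    mention of the trees. *)
Hypothesis coprime_closed : forall d,
  (forall D : {set T}, (forall x y, x \in D -> y \notin D -> fr x y) ->
     d %| #|D|) -> d = 1.

Lemma reach_hamiltonian c s t :
  path.cycle eX c -> uniq c -> (forall x, x \in c) -> reach s t.
Proof.
move=> cc uc allc; have off : eq_off c s t by move=> x; rewrite allc.
apply: (reach_off cc uc off).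
have wall x : x \in map s c.
  by apply/mapP; exists (s^-1 x)%g; rewrite ?permKV.
have uw : uniq (map s c) by rewrite map_inj_uniq //; apply: perm_inj.
apply: cyc_of_rot1 (perm_map_off uc off).
  by move=> r; apply: ceq_map.
pose closed (D : {set T}) := [forall x in D, forall y in ~: D, fr x y].
(* The rotations by [#|D|] for all closed [D] generate the one by their gcd, which is 1; the neutral
   element 0 stands for the trivial rotation. *)
pose d := \big[gcdn/0]_(D : {set T} | closed D) #|D|.
have -> : 1 = d.
  apply/esym/coprime_closed => D fD; apply: biggcdn_inf (dvdnn _).
  by apply/forall_inP=> x xD; apply/forall_inP=> y; rewrite inE; apply: fD.
rewrite /d; elim/big_rec: _ => [|D k /forall_inP cD].
  exact: cyc_refl.
apply: (cyc_rotn_gcd frC).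
have -> : #|D| = size [seq x <- map s c | x \in D].
  rewrite -(card_uniqP _) ?filter_uniq //; apply: eq_card => x.
  by rewrite mem_filter wall andbT.
apply: (@cyc_rotn_block _ _ frC _ _ _ [seq x <- map s c | x \notin D]).
- by move=> r; apply: ceq_map.
- by rewrite perm_sym perm_filterC.
move=> x y; rewrite !mem_filter => /andP[xD _] /andP[yD _].
by move/forall_inP: (cD x xD); apply; rewrite inE.
Qed.

End Puzzle.

Lemma ord3_third (i j : 'I_3) : exists k, (k != i) && (k != j).
Proof.
apply/existsP; apply: contraT; rewrite negb_exists => /forallP all.
suff : #|'I_3| <= #|[set i; j]| by rewrite card_ord cards2; case: (i != j).
apply/subset_leq_card/subsetP=> k _; rewrite !inE.
by have := all k; rewrite negb_and !negbK.
Qed.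

Lemma ord3_all (i j k l : 'I_3) : i != j -> i != k -> j != k ->
  [|| l == i, l == j | l == k].
Proof.
move=> ij ik jk; apply: contraT; rewrite !negb_or => /and3P[li lj lk].
have : uniq [:: l; i; j; k] by rewrite /= !inE !negb_or li lj lk ij ik jk.
move/card_uniqP=> E; have := max_card (mem [:: l; i; j; k]).
by rewrite E card_ord.
Qed.

(** * Theta graphs *)

Section Theta.

Variables (T : finType) (eX fr : rel T).
Hypotheses (eXC : symmetric eX) (frC : symmetric fr).

Implicit Types (s t : {perm T}) (P : 'I_3 -> seq T) (i j k : 'I_3).

Notation reach := (reach eX fr).

(** [P k] is the interior of the [k]-th path from [u] to [v], possibly empty; [theta_uniq] keeps the
    ends distinct and out of the rooms. *)
Record theta (u v : T) P : Prop := Theta {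
  theta_uniq : forall k, uniq (u :: rcons (P k) v);
  theta_path : forall k, path eX u (rcons (P k) v);
  theta_disj : forall i j x, x \in P i -> x \in P j -> i = j;
  theta_cover : forall x, x \notin [:: u; v] -> exists k, x \in P k }.

(** What is proved at the end [u] thereby holds at [v]. *)
Lemma theta_rev u v P : theta u v P -> theta v u (rev \o P).
Proof.
move=> [un pa di co]; split=> [k|k|i j x|x] /=.
- by have := un k; rewrite -rev_uniq -rcons_cons rev_rcons rev_cons.
- rewrite -rev_cons -(belast_rcons u _ v) -{1}(last_rcons u (P k) v) rev_path.
  by rewrite (eq_path (e' := eX)).
- by rewrite !mem_rev; apply: di.
rewrite !inE orbC => xuv; have [|k xk] := co x; first by rewrite !inE.
by exists k; rewrite /= mem_rev.
Qed.

(** * Rooms, loops and exits *)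

Section Structure.

Variables (u v : T) (P : 'I_3 -> seq T).
Hypothesis th : theta u v P.

Lemma theta_uNP k : u \notin P k.
Proof.
have := theta_uniq th k; rewrite cons_uniq mem_rcons inE negb_or -andbA.
by case/and3P.
Qed.

Lemma theta_vNP k : v \notin P k.
Proof.
by have := theta_uniq th k; rewrite cons_uniq rcons_uniq => /and3P[].
Qed.

Lemma theta_uniqP k : uniq (P k).
Proof.
by have := theta_uniq th k; rewrite cons_uniq rcons_uniq => /and3P[].
Qed.

Lemma theta_uv : u != v.
Proof.
have := theta_uniq th ord0; rewrite cons_uniq mem_rcons inE negb_or.
by case/andP=> /andP[].
Qed.

Lemma theta_neq i j x y : x \in P i -> y \in P j -> i != j -> x != y.
Proof.
move=> xi yj; apply: contraNneq => E; apply/eqP; apply: (theta_disj th xi).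
by rewrite E.
Qed.

Lemma theta_notin i j x : x \in P i -> i != j -> x \notin P j.
Proof.
move=> xi; apply: contraNN => xj; apply/eqP; exact: (theta_disj th xi xj).
Qed.

Lemma theta_avoid1 x : exists i, forall k, k != i -> x \notin P k.
Proof.
have [|xuv] := boolP (x \in [:: u; v]).
  rewrite !inE => /orP[]/eqP->; exists ord0 => k _.
    exact: theta_uNP.
  exact: theta_vNP.
have [i xi] := theta_cover th xuv; exists i => k ki.
by apply: theta_notin xi _; rewrite eq_sym.
Qed.

(** Each vertex lies in at most one of the three rooms. *)
Lemma theta_avoid x y : exists k, (x \notin P k) && (y \notin P k).
Proof.
have [i xi] := theta_avoid1 x; have [j yj] := theta_avoid1 y.
by have [k /andP[ki kj]] := ord3_third i j; exists k; rewrite xi // yj.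
Qed.

Definition loop i j := u :: P i ++ v :: rev (P j).

Lemma loop_cycle i j : path.cycle eX (loop i j).
Proof.
rewrite /= rcons_cat rcons_cons -cat_rcons cat_path (theta_path th).
rewrite last_rcons /=; exact: theta_path (theta_rev th) j.
Qed.

Lemma loop_uniq i j : i != j -> uniq (loop i j).
Proof.
move=> ij; have := theta_uniq th i; rewrite cons_uniq rcons_uniq.
case/and3P=> uPi vPi uqi; rewrite /loop -cat_rcons -cat_cons cat_uniq.
rewrite (theta_uniq th) rev_uniq theta_uniqP andbT /=.
apply/hasPn=> x; rewrite mem_rev => xj.
have xi : x \notin P i by apply: (theta_notin xj); rewrite eq_sym.
rewrite inE mem_rcons inE !negb_or xi andbT.
by apply/andP; split; apply: contraTneq xj => ->; rewrite ?theta_uNP ?theta_vNP.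
Qed.

Lemma mem_loop i j x :
  (x \in loop i j) = [|| x == u, x == v, x \in P i | x \in P j].
Proof.
rewrite inE mem_cat inE mem_rev.
by do !case: (x \in _); case: (x == u); case: (x == v).
Qed.

Lemma loop_off i j k x : i != j -> i != k -> j != k ->
  (x \in loop i j) = (x \notin P k).
Proof.
move=> ij ik jk; rewrite mem_loop; have [|xuv] := boolP (x \in [:: u; v]).
  rewrite !inE => /orP[]/eqP->; rewrite ?eqxx ?orbT.
    by rewrite theta_uNP.
  by rewrite theta_vNP.
have [l xl] := theta_cover th xuv; move: (xuv); rewrite !inE negb_or.
case/andP=> /negPf-> /negPf->; have := ord3_all l ij ik jk.
case/or3P=> /eqP E; rewrite {l}E in xl.
- by rewrite xl (theta_notin xl).
- by rewrite xl orbT (theta_notin xl).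
by rewrite xl; do 2 rewrite (negPf (theta_notin xl _)) 1?eq_sym //.
Qed.

Lemma third_loop k : exists i j, [/\ i != j, i != k & j != k].
Proof.
have [i /andP[ik _]] := ord3_third k k; have [j /andP[ji jk]] := ord3_third i k.
by exists i, j; rewrite eq_sym.
Qed.

Hypothesis leaf : forall r : seq T, uniq r -> r != [::] ->
  exists2 l, l \in r &
    exists n, {in r, forall y, y != l -> y != n -> fr l y}.

(** The places outside room [k] form the loop through the other two rooms, on which [z] is
    isolated. *)
Lemma reach_off_room k z s t : (s^-1 z)%g \notin P k ->
    (forall y, y != z -> (s^-1 y)%g \notin P k -> fr z y) ->
  {in P k, s =1 t} -> reach s t.
Proof.
move=> zk fz off; have [i [j [ij ik jk]]] := third_loop k.
have memE x : (x \in map s (loop i j)) = ((s^-1 x)%g \notin P k).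
  rewrite -{1}(permKV s x) mem_map ?(loop_off _ ij ik jk) //.
  exact: perm_inj.
apply: (reach_isolated frC leaf (loop_cycle i j) (loop_uniq ij) (z := z)).
- by rewrite memE.
- by move=> y; rewrite memE => yk yz; apply: fz.
by move=> x; rewrite (loop_off _ ij ik jk) negbK => /off.
Qed.

(** Nothing is said about [fr l w]: [l] is a leaf attached to [w], or isolated. *)
Definition pendant l w := l != w /\ forall y, y != l -> y != w -> fr l y.

(** The only person who could block [l], namely [w], is shut in room [k]. *)
Lemma reach_off_pendant l w k s t : pendant l w ->
    (s^-1 w)%g \in P k -> (s^-1 l)%g \notin P k ->
  {in P k, s =1 t} -> reach s t.
Proof.
move=> [_ fl] wk lk; apply: (reach_off_room lk) => y yl yk; apply: fl => //.
by apply: contraNneq yk => ->.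
Qed.

Lemma walk l a c x s : path eX a (rcons c x) -> uniq (a :: rcons c x) ->
    s x = l -> {in a :: c, forall y, fr l (s y)} ->
  exists t, [/\ reach s t, map t (a :: rcons c x) = l :: map s (a :: c)
    & eq_off (a :: rcons c x) s t].
Proof.
move=> pc uc sx fl; apply: reach_lin => //.
rewrite -rcons_cons map_rcons sx -cats1; apply: lin_block => y0 z.
by case/mapP=> y yc ->; rewrite inE => /eqP->; rewrite frC fl.
Qed.

(* [l] has left room [k] through the end [e], pushing the person at [e] in. *)
Definition exited k l e s t :=
  [/\ reach s t, t e = l, (forall x, x != e -> x \notin P k -> t x = s x) &
    forall y, y != l -> (s^-1 y)%g \in P k -> (t^-1 y)%g \in P k].

Lemma exit_along k l A x B s : P k = A ++ x :: B -> s x = l ->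
    {in u :: A, forall y, fr l (s y)} ->
  exists t, exited k l u s t.
Proof.
move=> Ek sx fl; have := theta_path th k; have := theta_uniq th k.
rewrite Ek rcons_cat rcons_cons -cat_rcons -cat_cons cat_uniq cat_path.
case/and3P=> uc /hasPn hc _ /andP[pc _].
have [t [st /= [tu tc] off]] := walk pc uc sx fl.
exists t; split=> // [y yu yk|y yl].
  apply: off; rewrite inE negb_or yu; apply: contraNN yk.
  by rewrite Ek mem_rcons mem_cat !inE => /orP[]->; rewrite ?orbT.
have mt : map t (rcons A x) =i s u :: map s A by move=> z; rewrite tc.
(* The people in [A] move one place away from [u], the person at [x] is [l] itself, and [B] is
   untouched. *)
rewrite !Ek !mem_cat !inE => /or3P[yA|/eqP E|yB].
- have : y \in map t (rcons A x).
    rewrite mt inE; apply/orP; right; apply/mapP.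
    by exists (s^-1 y)%g; rewrite ?permKV.
  case/mapP=> z; rewrite mem_rcons inE => zc ->; rewrite permK.
  by case/orP: zc => ->; rewrite ?orbT.
- by rewrite -sx -E permKV eqxx in yl.
have yE : t (s^-1 y)%g = y.
  rewrite off ?permKV //; have := hc (s^-1 y)%g.
  by rewrite mem_rcons inE yB orbT => /(_ isT).
by rewrite -yE permK yB !orbT.
Qed.

Lemma exit_pendant k l w A B s : pendant l w ->
    P k = A ++ (s^-1 l)%g :: B -> (s^-1 w)%g \notin u :: A ->
  exists t, exited k l u s t.
Proof.
move=> [lw fl] E wA; apply: (exit_along E); first by rewrite permKV.
have := theta_uniq th k.
rewrite E rcons_cat -cat_cons cat_uniq rcons_cons /= negb_or.
case/and3P=> _ /andP[lA _] _ y yA; apply: fl.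
  by apply: contraNneq lA => <-; rewrite permK.
by apply: contraNneq wA => <-; rewrite permK.
Qed.

End Structure.

(** * Rearranging people on a theta graph *)

Section Dynamics.

Variables (u v : T) (P : 'I_3 -> seq T).
Hypothesis th : theta u v P.

Hypothesis leaf : forall r : seq T, uniq r -> r != [::] ->
  exists2 l, l \in r &
    exists n, {in r, forall y, y != l -> y != n -> fr l y}.

Lemma exited_rev k l e s t :
  exited (rev \o P) k l e s t -> exited P k l e s t.
Proof.
case=> st te off inP; split=> // [x xe|y yl].
  by rewrite -mem_rev; apply: off.
by have := inP y yl; rewrite /= !mem_rev.
Qed.

(** Since [w] is neither in the room nor at [e], nobody on the way to [e] blocks [l]. *)
Lemma exit_at k l w e s : e \in [:: u; v] -> pendant l w ->
    (s^-1 l)%g \in P k -> (s^-1 w)%g \notin P k -> s e != w ->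
  exists t, exited P k l e s t.
Proof.
move=> euv lw lk wk ew; have {}ew : (s^-1 w)%g != e.
  by apply: contraNneq ew => <-; rewrite permKV.
move: euv ew; rewrite !inE => /orP[]/eqP-> ew.
  have [A [B E]] := mem_split lk; apply: (exit_pendant th lw E).
  by rewrite inE negb_or ew; apply: contraNN wk => wA; rewrite E mem_cat wA.
have [A [B E]] : exists A B, (rev \o P) k = A ++ (s^-1 l)%g :: B.
  by apply: mem_split; rewrite mem_rev.
have [|t /exited_rev] := exit_pendant (theta_rev th) lw E; last by exists t.
rewrite inE negb_or ew; apply: contraNN wk => wA.
by rewrite -mem_rev -/((rev \o P) k) E mem_cat wA.
Qed.

(** In the room, [w] stands on one side of [l], so [l] leaves on the other side. *)
Lemma exit_some k l w s : pendant l w ->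
    (s^-1 l)%g \in P k -> (s^-1 w)%g \in P k ->
  exists e t, e \in [:: u; v] /\ exited P k l e s t.
Proof.
move=> lw lk wk; have uq := theta_uniqP th k.
have [A [B E]] := mem_split lk.
have [wA|wA] := boolP ((s^-1 w)%g \in A); last first.
  have [|t ?] := exit_pendant th lw E.
    by rewrite inE negb_or wA andbT; apply: contraTneq wk => ->;
       apply: (theta_uNP th).
  by exists u, t; rewrite mem_head.
have Er : (rev \o P) k = rev B ++ (s^-1 l)%g :: rev A.
  by rewrite /= E rev_cat rev_cons cat_rcons.
have [|t /exited_rev ?] := exit_pendant (theta_rev th) lw Er; last first.
  by exists v, t; rewrite !inE eqxx orbT.
rewrite inE mem_rev negb_or; apply/andP; split.
  by apply: contraTneq wk => ->; apply: (theta_vNP th).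
apply: contraTN uq => wB; rewrite E cat_uniq negb_and; apply/orP; right.
by rewrite negb_and negbK; apply/orP; left; apply/hasP; exists (s^-1 w)%g;
  rewrite // inE wB orbT.
Qed.

(** Sort by transpositions: swapping [x] with the place of [t x] makes [x] right and spoils no place
    that was right, so the number of wrong places drops. *)
Lemma reach_tperms (S : {pred T}) t :
    (forall s, {in S, s =1 t} -> forall x y,
       x \notin S -> y \notin S -> x != y -> reach s (tperm x y * s)%g) ->
  forall s, {in S, s =1 t} -> reach s t.
Proof.
move=> swap s; move: {2}(#|_|) (leqnn #|[pred x | s x != t x]|) => m.
elim: m s => [|m IH] s dm st.
  have -> : s = t; last exact: connect0.
  apply/permP=> x; apply/eqP; apply: contraTT dm => sx.
  by rewrite -ltnNge; apply/card_gt0P; exists x.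
have [x sx|st1] := pickP [pred x | s x != t x]; last first.
  have -> : s = t; last exact: connect0.
  by apply/permP=> x; apply/eqP; have := st1 x; rewrite /= => /negbFE.
set y := (s^-1 (t x))%g; have sy : s y = t x by rewrite permKV.
have xy : x != y by apply: contraNneq sx => E; rewrite /= -sy -E.
have xS : x \notin S by apply: contraNN sx => /st ->.
have yS : y \notin S.
  by apply: contraNN xy => /st; rewrite sy => /perm_inj ->.
apply: (reach_trans (swap s st x y xS yS xy)); apply: IH; last first.
  move=> z zS; rewrite permM tpermD ?st //.
    by apply: contraNneq xS => ->.
  by apply: contraNneq yS => ->.
rewrite -ltnS; apply: leq_trans dm; apply: proper_card; apply/properP.
split; last by exists x; rewrite // inE permM tpermL sy eqxx.
apply/subsetP=> z; rewrite !inE permM.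
case: tpermP => [->|->|//]; first by rewrite sy eqxx.
by rewrite sy [t x == _](inj_eq perm_inj) eq_sym => _.
Qed.

Lemma tperm_off (S : {pred T}) s x y : x \notin S -> y \notin S ->
  {in S, s =1 (tperm x y * s)%g}.
Proof.
move=> xS yS z zS; rewrite permM tpermD //.
  by apply: contraNneq xS => ->.
by apply: contraNneq yS => ->.
Qed.

(** Induction on the places: one transposition serves [x], which then joins the set of places to be
    kept. *)
Lemma assign (S : {pred T}) s (xs ys : seq T) : size xs = size ys ->
    uniq xs -> uniq ys -> {in xs, forall x, x \notin S} ->
    {in ys, forall y, (s^-1 y)%g \notin S} ->
  exists2 t : {perm T}, {in S, s =1 t} & map t xs = ys.
Proof.
elim: xs ys S s => [|x xs IH] [|y ys] //= S s.
  by move=> _ _ _ _ _; exists s.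
case=> sz /andP[xxs uxs] /andP[yys uys] xS yS.
have xS' := xS x (mem_head _ _); have yS' := yS y (mem_head _ _).
pose s1 := (tperm x (s^-1 y) * s)%g.
have s1x : s1 x = y by rewrite permM tpermL permKV.
have s1S : {in S, s =1 s1} by apply: tperm_off.
have [||t tS <-] := IH ys [predU1 x & S] s1 sz uxs uys.
- move=> z zxs; rewrite inE negb_or xS ?inE ?zxs ?orbT // andbT.
  by apply: contraNneq xxs => <-.
- move=> z zys; rewrite inE negb_or; apply/andP; split.
    by apply: contraNneq yys => E; rewrite -s1x -E permKV.
  have := yS z; rewrite inE zys orbT => /(_ isT); apply: contraNN => zS.
  by rewrite -[z in (s^-1 z)%g](permKV s1) -s1S // permK.
exists t => [z zS|]; first by rewrite s1S // tS // inE zS orbT.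
by rewrite -tS ?s1x // inE eqxx.
Qed.

Lemma reach_dominant z s t : (forall y, y != z -> fr z y) -> reach s t.
Proof.
move=> fz.
have to_u r : exists2 r', reach r r' & r' u = z.
  have [E|xu] := eqVneq u (r^-1 z)%g.
    by exists r; [exact: connect0|rewrite E permKV].
  have [k xk] : exists k, (r^-1 z)%g \in rcons (P k) v.
    have [xuv|/(theta_cover th)[k xk]] := boolP ((r^-1 z)%g \in [:: u; v]).
      exists ord0; move: xuv; rewrite !inE mem_rcons inE.
      by rewrite eq_sym (negPf xu) /= => ->.
    by exists k; rewrite mem_rcons inE xk orbT.
  have [A [B E]] := mem_split xk.
  have := theta_path th k; have := theta_uniq th k.
  rewrite E -cat_rcons -cat_cons cat_uniq cat_path => /andP[uA _] /andP[pA _].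
  have [|r' [rr' [r'u _] _]] := walk pA uA (permKV r z); last by exists r'.
  move=> y yA; apply: fz; apply: contraTneq uA => <-; rewrite permK.
  by rewrite -rcons_cons rcons_uniq yA.
have [s' ss' s'u] := to_u s; have [t' tt' t'u] := to_u t.
apply: (reach_trans ss'); rewrite reach_sym // in tt'; apply: reach_trans tt'.
(* With [z] kept at [u], any two other places are swapped on a loop avoiding a room that contains
   neither. *)
apply: (@reach_tperms (pred1 u)); last by move=> x /eqP->; rewrite t'u.
move=> r ru x y xu yu xy; have {}ru : r u = z by rewrite ru ?inE.
have [k /andP[xk yk]] := theta_avoid th x y.
apply: (reach_off_room th leaf (k := k) (z := z)).
- by rewrite -ru permK (theta_uNP th).
- by move=> a az _; apply: fz.
exact: tperm_off.
Qed.

(** * Two leaves with distinct neighbours *)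

Section TwoLeaves.

Hypothesis P0 : forall k, P k != [::].

(** Indexed by [bool], so that [~~ b] names the other leaf and each lemma serves both. *)
Variables (L W : bool -> T).
Hypothesis LW : forall b, pendant (L b) (W b).
Hypothesis uLW : uniq [:: L true; L false; W true; W false].

Let LWneq b c : L b != W c.
Proof.
move: uLW; rewrite /= !inE !negb_or.
by case/and4P=> /and3P[_ ? ?] /andP[? ?] _ _; case: b c => [] [].
Qed.

Let Lneq : L true != L false.
Proof. by move: uLW; rewrite /= !inE !negb_or => /and4P[/and3P[]]. Qed.

Let Wneq : W true != W false.
Proof. by move: uLW; rewrite /= !inE !negb_or => /and4P[]. Qed.

Lemma room_mem k : exists x, x \in P k.
Proof. by have := P0 k; case: (P k) => // x r _; exists x; apply: mem_head. Qed.

(* [L b] is a leaf attached to [W b], and [K b] is the room of [W b]. *)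
Definition settled s (q : bool -> T) (K : bool -> 'I_3) :=
  [/\ s u = L true, s v = L false, forall b, s (q b) = W b,
      forall b, q b \in P (K b) & K true != K false].

Lemma settled_L s q K b k : settled s q K -> (s^-1 (L b))%g \notin P k.
Proof.
case=> su sv _ _ _; case: b; rewrite -?su -?sv permK.
  exact: (theta_uNP th).
exact: (theta_vNP th).
Qed.

Lemma settled_W s q K b : settled s q K -> (s^-1 (W b))%g \in P (K b).
Proof. by case=> _ _ sq qP _; rewrite -sq permK. Qed.

Lemma settled_reach s t q K b : settled s q K ->
  {in P (K b), s =1 t} -> reach s t.
Proof.
move=> sK; apply: (reach_off_pendant th leaf (LW b)).
  exact: settled_W sK.
exact: settled_L sK.
Qed.

(** Sort by transpositions that keep the ends and the places of both [W b]. Two places outside [K b]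
    are swapped on the free loop avoiding that room. *)
Lemma settled_fix s t q q' K K' : settled s q K -> settled t q' K' -> q =1 q' ->
  reach s t.
Proof.
move=> [su sv sq qP KN] [tu tv tq _ _] qq'.
pose S := mem [:: u; v; q true; q false].
apply: (@reach_tperms S); last first.
  move=> x; rewrite !inE => /or4P[]/eqP->; rewrite ?su ?sv ?sq ?tu ?tv //.
    by rewrite (qq' true) tq.
  by rewrite (qq' false) tq.
have SE (r : {perm T}) : {in S, r =1 t} -> settled r q K.
  move=> rS; split=> //; rewrite ?rS ?tu ?tv ?inE ?eqxx ?orbT // => b.
  by rewrite rS qq' // -qq'; case: b; rewrite !inE eqxx ?orbT.
have one (r : {perm T}) b x y : {in S, r =1 t} -> x \notin S -> y \notin S ->
    x \notin P (K b) -> y \notin P (K b) ->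
    reach r (tperm x y * r)%g /\ {in S, (tperm x y * r)%g =1 t}.
  move=> rS xS yS xb yb; split.
    apply: (settled_reach (b := b) (SE r rS)).
    exact: tperm_off.
  by move=> z zS; rewrite -(tperm_off r xS yS) // rS.
move=> r rS x y xS yS xy.
have room z : z \notin S -> exists k, z \in P k.
  move=> zS; apply: (theta_cover th); move: zS.
  by rewrite !inE !negb_or => /and4P[-> ->].
have [k1 xk] := room x xS; have [k2 yk] := room y yS.
have notP a k b : a \in P k -> k != K b -> a \notin P (K b).
  exact: (theta_notin th).
have [b /andP[b1 b2]|mix] := pickP [pred b | (k1 != K b) && (k2 != K b)].
  by have [] := one r b x y rS xS yS (notP _ _ _ xk b1) (notP _ _ _ yk b2).
have [k3 /andP[k3t k3f]] := ord3_third (K true) (K false).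
have k3N b : k3 != K b by case: b.
have [z zk] := room_mem k3.
have zS : z \notin S.
  rewrite !inE !negb_or; apply/and4P; split.
  - by apply: contraTneq zk => ->; apply: (theta_uNP th).
  - by apply: contraTneq zk => ->; apply: (theta_vNP th).
  - exact: (theta_neq th zk (qP true)).
  - exact: (theta_neq th zk (qP false)).
have K1 : exists b, k1 != K b.
  case: (eqVneq k1 (K true)) => [->|?]; last by exists true.
  by exists false.
have K2 : exists b, k2 != K b.
  case: (eqVneq k2 (K true)) => [->|?]; last by exists true.
  by exists false.
case: K1 K2 => b1 k1b [b2 k2b].
have xb := notP _ _ _ xk k1b; have yb := notP _ _ _ yk k2b.
have zb b := notP _ _ b zk (k3N b).
have [r1 S1] := one r b1 x z rS xS zS xb (zb b1).
have [r2 S2] := one _ b2 y z S1 yS zS yb (zb b2).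
have [r3 S3] := one _ b1 x z S2 xS zS xb (zb b1).
have yz : y != z.
  apply: contraNneq (zb b1) => E; move: (mix b1).
  by rewrite -E /= k1b /= => /negbFE/eqP<-.
(* [x] and [y] lie in the rooms of the two [W b]; go through the third room. *)
have -> : (tperm x y * r = tperm x z * (tperm y z * (tperm x z * r)))%g.
  rewrite !mulgA; congr (_ * r)%g.
  have := tpermJ y z (tperm x z); rewrite /conjg tpermV mulgA => ->.
  by rewrite tpermR tpermD 1?(eq_sym z) // tpermC.
exact: reach_trans r1 (reach_trans r2 r3).
Qed.

Definition upd A (f : bool -> A) b a c := if c == b then a else f c.

(** The loop avoiding the room of [W (~~ b)] is free, and both [q b] and [x] are on it. *)
Lemma settled_move s q K b x j : settled s q K -> x \in P j -> j != K (~~ b) ->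
  exists2 t, reach s t & settled t (upd q b x) (upd K b j).
Proof.
move=> sK xj jb; have [su sv sq qP KN] := sK.
have qN : q b \notin P (K (~~ b)).
  by apply: (theta_notin th (qP b)); case: (b); rewrite // eq_sym.
have xN : x \notin P (K (~~ b)) by apply: (theta_notin th xj).
exists (tperm (q b) x * s)%g.
  apply: (settled_reach (b := ~~ b) sK); exact: tperm_off.
have fixed y : (forall k, y \notin P k) -> (tperm (q b) x * s)%g y = s y.
  move=> yP; rewrite permM tpermD //.
    by apply: contraNneq (yP (K b)) => <-.
  by apply: contraNneq (yP j) => <-.
split.
- by rewrite fixed // => k; apply: (theta_uNP th).
- by rewrite fixed // => k; apply: (theta_vNP th).
- move=> c; rewrite /upd; case: eqP => [->|/eqP cb].
    by rewrite permM tpermR.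
  have -> : c = ~~ b by case: (c) (b) cb => [] [].
  rewrite permM tpermD //.
    by apply: contraNneq qN => ->.
  by apply: contraNneq xN => ->.
- by move=> c; rewrite /upd; case: eqP => // _.
by rewrite /upd; case: (b) jb => //= jb; rewrite eq_sym.
Qed.

Lemma settled_reach_settled s t q q' K K' :
  settled s q K -> settled t q' K' -> reach s t.
Proof.
move=> sK tK; have [_ _ _ q'P K'N] := tK.
have direct s1 q1 K1 : settled s1 q1 K1 -> K' true != K1 false -> reach s1 t.
  move=> sK1 N1; have [s2 r2 sK2] := settled_move (b := true) sK1 (q'P true) N1.
  have [|s3 r3 sK3] := settled_move (b := false) sK2 (q'P false).
    by rewrite /upd /= eq_sym.
  apply: (reach_trans r2 (reach_trans r3 _)).
  by apply: (settled_fix sK3 tK) => -[].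
have [E|N] := eqVneq (K' true) (K false); last exact: direct sK N.
(* Here [W false] occupies the room meant for [W true] and first steps aside into the third room. *)
have [k /andP[kt kf]] := ord3_third (K true) (K false).
have [z zk] := room_mem k.
have [s1 r1 sK1] := settled_move (b := false) sK zk kt.
by apply: (reach_trans r1); apply: direct sK1 _; rewrite E /upd /= eq_sym.
Qed.

(** Of the four people only [W b] is in room [k], so the loop avoiding this room is free and
    contains the other three, who are sent to their places. *)
Lemma settle_in b k s :
    (s^-1 (W b))%g \in P k -> (s^-1 (L b))%g \notin P k ->
    (s^-1 (L (~~ b)))%g \notin P k -> (s^-1 (W (~~ b)))%g \notin P k ->
  exists t q K, reach s t /\ settled t q K.
Proof.
move=> Wk Lk LNk WNk; have [k' /andP[k'k _]] := ord3_third k k.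
have [x xk'] := room_mem k'.
have xk : x \notin P k := theta_notin th xk' k'k.
have uk := theta_uNP th; have vk := theta_vNP th.
have [||||| t st] := @assign (mem (P k)) s [:: u; v; x]
  [:: L true; L false; W (~~ b)].
- by [].
- rewrite /= !inE negb_or (theta_uv th) /= andbT; apply/andP; split.
    by apply: contraTneq xk' => <-.
  by apply: contraTneq xk' => <-.
- by rewrite /= !inE negb_or Lneq !LWneq.
- by apply/allP; rewrite /= uk vk xk.
- by apply/allP; rewrite /= WNk andbT; case: (b) Lk LNk => -> ->.
case=> tu tv tx; exists t, (fun c => if c == b then s^-1 (W b) else x)%g.
exists (fun c => if c == b then k else k'); split.
  exact: (reach_off_pendant th leaf (LW b) Wk Lk).
split=> // [c|c|].
- case: eqP => [->|/eqP cb]; first by rewrite -st // permKV.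
  by rewrite tx; case: (c) (b) cb => [] [].
- by case: eqP.
by case: (b); rewrite //= eq_sym.
Qed.

Lemma settle b k s :
    (s^-1 (W b))%g \in P k -> (s^-1 (L b))%g \notin P k ->
    (s^-1 (W (~~ b)))%g \notin P k ->
  exists t q K, reach s t /\ settled t q K.
Proof.
move=> Wk Lk WNk.
have [LNk|LNk] := boolP ((s^-1 (L (~~ b)))%g \in P k); last first.
  exact: settle_in LNk WNk.
(* [L (~~ b)] shares room [k] with [W b] and has to come out at [u]. Beforehand [W (~~ b)] and [L b]
   are parked in the two other rooms, where they neither obstruct it nor get pushed into room
   [k]. *)
have [k' /andP[k'k _]] := ord3_third k k.
have [k'' /andP[k''k k''k']] := ord3_third k k'.
have [x xk'] := room_mem k'; have [y yk''] := room_mem k''.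
have xk : x \notin P k := theta_notin th xk' k'k.
have yk : y \notin P k := theta_notin th yk'' k''k.
have yx : y != x := theta_neq th yk'' xk' k''k'.
have [||||| t st] := @assign (mem (P k)) s [:: x; y] [:: W (~~ b); L b].
- by [].
- by rewrite /= inE eq_sym yx.
- by rewrite /= inE eq_sym LWneq.
- by apply/allP; rewrite /= xk yk.
- by apply/allP; rewrite /= WNk Lk.
case=> tx ty.
have rt : reach s t := reach_off_pendant th leaf (LW b) Wk Lk st.
have tE z : (s^-1 z)%g \in P k -> (t^-1 z)%g \in P k.
  by move=> zk; rewrite -[z in (t^-1 z)%g](permKV s) st // permK.
have tuW : t u != W (~~ b).
  rewrite -tx (inj_eq perm_inj); apply: contraTneq xk' => <-.
  exact: (theta_uNP th).
have [|r [tr ru off stay]] :=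
  exit_at (mem_head u [:: v]) (LW (~~ b)) (tE _ LNk) _ tuW.
  by rewrite -tx permK.
have fixed z j : z \in P j -> j != k -> r z = t z.
  move=> zj jk; apply: off; last exact: (theta_notin th zj).
  by apply: contraTneq zj => ->; apply: (theta_uNP th).
have [|||| w [q [K [rw wK]]]] := @settle_in b k r.
- by apply: stay (tE _ Wk); rewrite eq_sym LWneq.
- by rewrite -ty -(fixed y k'') // permK.
- by rewrite -ru permK (theta_uNP th).
- by rewrite -tx -(fixed x k') // permK.
by exists w, q, K; split=> //; apply: reach_trans (reach_trans rt tr) rw.
Qed.

(** Take a room without [W true] and [W false]. If [L true] is in it, it leaves through an end held
    by neither; if they hold both ends, they are in no room, and any other room avoids all three. *)
Lemma reach_common_loop s : exists t k, [/\ reach s t,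
  (t^-1 (W true))%g \notin P k, (t^-1 (W false))%g \notin P k
  & (t^-1 (L true))%g \notin P k].
Proof.
have [k /andP[x1 x2]] := theta_avoid th (s^-1 (W true))%g (s^-1 (W false))%g.
have [lk|lk] := boolP ((s^-1 (L true))%g \in P k); last first.
  by exists s, k; split=> //; apply: connect0.
have byexit e : e \in [:: u; v] -> s e != W true -> s e != W false ->
    exists t k, [/\ reach s t, (t^-1 (W true))%g \notin P k,
      (t^-1 (W false))%g \notin P k & (t^-1 (L true))%g \notin P k].
  move=> euv e1 e2; have [t [st te off _]] := exit_at euv (LW true) lk x1 e1.
  have fixed c : s e != W c -> (s^-1 (W c))%g \notin P k ->
      (t^-1 (W c))%g \notin P k.
    move=> ec ck; rewrite -[in (t^-1 _)%g](permKV s (W c)) -off // ?permK //.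
    by apply: contraNneq ec => <-; rewrite permKV.
  exists t, k; split=> //; try exact: fixed.
  rewrite -te permK; move: euv; rewrite !inE => /orP[]/eqP->.
    exact: (theta_uNP th).
  exact: (theta_vNP th).
have uv2 : v \in [:: u; v] by rewrite !inE eqxx orbT.
have [u1|u1] := eqVneq (s u) (W true); have [v1|v1] := eqVneq (s v) (W true).
- by have := theta_uv th; rewrite -(inj_eq (@perm_inj _ s)) u1 v1 eqxx.
- have [v2|v2] := eqVneq (s v) (W false); last exact: (byexit v).
  have [k' /andP[k'k _]] := ord3_third k k; exists s, k'; split.
  + exact: connect0.
  + by rewrite -u1 permK (theta_uNP th).
  + by rewrite -v2 permK (theta_vNP th).
  by apply: (theta_notin th lk); rewrite eq_sym.
- have [u2|u2] := eqVneq (s u) (W false); last exact: (byexit u (mem_head _ _)).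
  have [k' /andP[k'k _]] := ord3_third k k; exists s, k'; split.
  + exact: connect0.
  + by rewrite -v1 permK (theta_vNP th).
  + by rewrite -u2 permK (theta_uNP th).
  by apply: (theta_notin th lk); rewrite eq_sym.
have [u2|u2] := eqVneq (s u) (W false); last exact: (byexit u (mem_head _ _)).
have [v2|v2] := eqVneq (s v) (W false); last exact: (byexit v).
by have := theta_uv th; rewrite -(inj_eq (@perm_inj _ s)) u2 v2 eqxx.
Qed.

(** * Bringing the two neighbours into different rooms *)

Variable D : {set T}.
Hypothesis frD : forall x y, x \in D -> y \notin D -> fr x y.
Hypotheses (LD : L true \in D) (WD : W true \in D) (WND : W false \notin D).

Lemma word_block (w : seq T) : uniq w ->
    W true \in w -> W false \in w -> L true \in w ->
  exists b r, [/\ perm_eq w ([:: L true; W true] ++ b ++ r),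
    {subset b <= D}, {in r, forall y, y \notin D} & W false \in r].
Proof.
move=> uw w1 w2 l1.
exists [seq y <- w | (y \in D) && (y \notin [:: L true; W true])].
exists [seq y <- w | y \notin D]; split.
- apply: uniq_perm => //.
    rewrite cat_uniq cat_uniq !filter_uniq // !andbT /= inE LWneq /=.
    apply/andP; split; apply/hasPn=> y /=.
      rewrite mem_cat !mem_filter => /orP[/andP[/andP[_ ->]] //|].
      case/andP=> yD _; rewrite !inE.
      by apply: contraNN yD => /orP[]/eqP->.
    by rewrite !mem_filter => /andP[/negPf-> _].
  move=> y; rewrite !mem_cat !mem_filter !inE.
  case: (eqVneq y (L true)) => [->|_] /=; first by rewrite l1.
  case: (eqVneq y (W true)) => [->|_] /=; first by rewrite w1.
  by rewrite andbT; case: (y \in D); rewrite ?orbF.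
- by move=> y; rewrite mem_filter => /andP[/andP[]].
- by move=> y; rewrite mem_filter => /andP[].
by rewrite mem_filter WND.
Qed.

(* The people of [D], arranged as a block led by [L true] and [W true], are
   pushed around the loop until [L true] is at [u] and [W true] just inside room
   [i]. If [W false] is in room [i] as well, the block is pushed back by two
   steps: [W true] ends up in room [j] and [W false] has not moved. *)
Lemma separate s : exists t b k, [/\ reach s t, (t^-1 (W b))%g \in P k,
  (t^-1 (L b))%g \notin P k & (t^-1 (W (~~ b)))%g \notin P k].
Proof.
have [s0 [k [ss0 w1k w2k l1k]]] := reach_common_loop s.
have [i [j [ij ik jk]]] := third_loop k.
set c := loop u v P i j.
have memE x : (x \in map s0 c) = ((s0^-1 x)%g \notin P k).
  rewrite -{1}(permKV s0 x) mem_map ?(loop_off th _ ij ik jk) //.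
  exact: perm_inj.
have cc : path.cycle eX c := loop_cycle th i j.
have uc : uniq c := loop_uniq th ij.
have us0 : uniq (map s0 c) by rewrite map_inj_uniq //; apply: perm_inj.
have [|||b [r [pw bD rD w2r]]] := word_block us0; rewrite ?memE //.
have r0 : r != [::] by case: (r) w2r.
have [n L0] := ceq_map frC leaf uc pw.
have fbr : {in [:: L true; W true] ++ b & r, forall x y, fr x y}.
  move=> x y xb /rD; apply: frD; move: xb.
  by rewrite mem_cat !inE => /orP[/orP[]/eqP->|/bD].
rewrite catA in L0; have [r' rr' L1] := cyc_shift n r0 fbr.
have [t [s0t tc _]] := reach_cyc cc uc (cyc_trans L0 L1).
have st := reach_trans ss0 s0t.
have Ex m : exists x C, P m = x :: C.
  by case: (P m) (P0 m) => // x C; exists x, C.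
have [[c1 [C Ei]] [a1 [A Ej]]] := (Ex i, Ex j).
have [tu tc1] : t u = L true /\ t c1 = W true.
  by move: tc; rewrite /c /loop Ei /= => -[].
have c1i : c1 \in P i by rewrite Ei mem_head.
have a1j : a1 \in P j by rewrite Ej mem_head.
have [w2i|w2i] := boolP ((t^-1 (W false))%g \in P i); last first.
  exists t, true, i; split=> //; first by rewrite -tc1 permK.
  by rewrite -tu permK (theta_uNP th).
have [B1 [B2 EB]] := mem_split w2i; set x := (t^-1 (W false))%g in EB.
have tx : t x = W false by rewrite permKV.
have [r1 [r2 Er]] : exists r1 r2, r' = r1 ++ W false :: r2.
  by apply: mem_split; rewrite -(perm_mem rr').
have ut : uniq (map t c) by rewrite map_inj_uniq //; apply: perm_inj.
have Ec : c = (u :: B1) ++ x :: B2 ++ v :: rev (P j).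
  by rewrite /c /loop EB -catA.
have Et : map t (u :: B1) ++ W false :: map t (B2 ++ v :: rev (P j)) =
    (([:: L true; W true] ++ b) ++ r1) ++ W false :: r2.
  by rewrite -[in LHS]tx -map_cons -map_cat -Ec tc Er -!catA.
(* [B1] holds the places strictly between [u] and [x]. [r2] fills the places behind [x], among them
   [v] and the nonempty room [j], hence at least two. *)
have [sz1 sz2] : size B1 = size b + size r1 + 1 /\ 2 <= size r2.
  have notin_pre (z : T) m1 m2 : uniq (m1 ++ z :: m2) -> z \notin m1.
    by rewrite cat_uniq /= negb_or => /and3P[_ /andP[]].
  have Et1 : map t c = (([:: L true; W true] ++ b) ++ r1) ++ W false :: r2.
    by rewrite tc Er -!catA.
  have wm1 : W false \notin map t (u :: B1).
    by apply: (notin_pre _ _ (map t (B2 ++ v :: rev (P j)))); rewrite Et -Et1.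
  have wm2 : W false \notin (([:: L true; W true] ++ b) ++ r1).
    by apply: (notin_pre _ _ r2); rewrite -Et1.
  have [E1 E2] := cat_uniq_inj Et wm1 wm2; split.
    have := congr1 size E1; rewrite size_map !size_cat /= => -[->].
    by rewrite addn1 addSn.
  rewrite -E2 size_map size_cat /= size_rev Ej /=.
  by rewrite addnC.
set r3 := take (size r2 - 2) r2; set e := drop (size r2 - 2) r2.
have sze : size e = 2 by rewrite size_drop subKn.
(* Cyclically, [e] stands just before the block; being outside [D], these two people pass through
   it. *)
have L2 : cyc fr (map t c)
    (b ++ e ++ (r1 ++ W false :: r3) ++ [:: L true; W true]).
  have -> : map t c = [:: L true; W true] ++ b ++ (r1 ++ W false :: r3) ++ e.
    by rewrite tc Er -[r2 in LHS](cat_take_drop (size r2 - 2)) -!catA.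
  apply: cyc_back => // y z yb ze; apply: fbr => //.
  rewrite (perm_mem rr') Er mem_cat inE -[r2](cat_take_drop (size r2 - 2)).
  by rewrite mem_cat -/e ze !orbT.
have [t2 [tt2 t2c _]] := reach_cyc cc uc L2.
have t2x : t2 x = W false.
  have /eqP : map t2 (u :: B1) ++ t2 x :: map t2 (B2 ++ v :: rev (P j)) =
      (b ++ e ++ r1) ++ W false :: r3 ++ [:: L true; W true].
    by rewrite -map_cons -map_cat -Ec t2c -!catA.
  rewrite eqseq_cat; last first.
    by rewrite size_map !size_cat /= sze sz1 addn1 addnCA.
  by case/andP=> _ /eqP[].
(* The loop ends with room [j] reversed, so its last place is the first one of that room. *)
have t2a : t2 a1 = W true.
  have := congr1 (last (t2 u)) t2c; rewrite !catA last_cat /= => <-.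
  by rewrite last_map last_cat /= Ej rev_cons last_rcons.
have st2 := reach_trans st tt2.
have w2E : (t2^-1 (W false))%g = x by rewrite -t2x permK.
have [l2i|l2i] := boolP ((t2^-1 (L false))%g \in P i); last first.
  exists t2, false, i; rewrite w2E; split=> //.
  by rewrite -t2a permK (theta_notin th a1j) // eq_sym.
have ai : a1 \notin P i by rewrite (theta_notin th a1j) // eq_sym.
(* [L false] shares room [i] with [W false] and leaves it; [W true], at [a1] inside room [j], is not
   affected. *)
have [|e0 [t3 [euv [t23 t3e off stay]]]] := exit_some (LW false) l2i.
  by rewrite w2E.
have eN k' : e0 \notin P k'.
  by move: euv; rewrite !inE => /orP[]/eqP->;
    rewrite ?(theta_uNP th) ?(theta_vNP th).
exists t3, false, i; split.
- exact: reach_trans st2 t23.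
- by apply: stay; rewrite ?w2E // eq_sym LWneq.
- by rewrite -t3e permK.
by rewrite -t2a -off ?permK //; apply: contraTneq a1j => ->.
Qed.

Lemma reach_two_leaves s t : reach s t.
Proof.
have to_settled r : exists r' q K, reach r r' /\ settled r' q K.
  have [r1 [b [k [rr1 Wk Lk WNk]]]] := separate r.
  have [r2 [q [K [r12 sK]]]] := settle Wk Lk WNk.
  by exists r2, q, K; split=> //; apply: reach_trans r12.
have [s' [q [K [ss' sK]]]] := to_settled s.
have [t' [q' [K' [tt' tK]]]] := to_settled t.
apply: (reach_trans ss'); rewrite reach_sym // in tt'.
exact: reach_trans (settled_reach_settled sK tK) tt'.
Qed.

End TwoLeaves.

End Dynamics.

End Theta.

(** * Connectedness on a theta graph *)

Section Abstract.

Variables (T : finType) (eX fr : rel T).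
Hypotheses (eXC : symmetric eX) (frC : symmetric fr).

Hypothesis leaf : forall r : seq T, uniq r -> r != [::] ->
  exists2 l, l \in r &
    exists n, {in r, forall y, y != l -> y != n -> fr l y}.

Hypothesis coprime_closed : forall d,
  (forall D : {set T}, (forall x y, x \in D -> y \notin D -> fr x y) ->
     d %| #|D|) -> d = 1.

Lemma theta_hamiltonian u v (P : 'I_3 -> seq T) : theta eX u v P ->
  (exists c, [/\ path.cycle eX c, uniq c & forall x, x \in c]) \/
  (forall k, P k != [::]).
Proof.
move=> th; have [k /eqP Pk|P0] := pickP [pred k | P k == [::]]; last first.
  by right=> k; have /= -> := P0 k.
have [i [j [ij ik jk]]] := third_loop k.
left; exists (loop u v P i j); split.
- exact: (loop_cycle eXC th).
- exact: (loop_uniq th ij).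
by move=> x; rewrite (loop_off th _ ij ik jk) Pk.
Qed.

(** If only the empty and the full set were closed, [#|T|] would divide the size of every closed set
    and so equal 1. *)
Lemma exists_closed : 1 < #|T| -> exists D : {set T},
  [/\ forall x y, x \in D -> y \notin D -> fr x y, D != set0 & ~: D != set0].
Proof.
move=> T1.
pose closed (D : {set T}) := [forall x in D, forall y in ~: D, fr x y].
have [D /and3P[/forall_inP cD D0 DT]|triv] :=
    pickP (fun D : {set T} => [&& closed D, D != set0 & ~: D != set0]).
  exists D; split=> // x y xD yD; move/forall_inP: (cD x xD); apply.
  by rewrite inE.
suff T1E : #|T| = 1 by rewrite T1E in T1.
apply: coprime_closed => D cD.
have cD' : closed D.
  by apply/forall_inP=> x xD; apply/forall_inP=> y; rewrite inE; apply: cD.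
have := triv D; rewrite cD' /=; case: eqP => [->|_]; first by rewrite cards0.
case: eqP => // /(congr1 (@setC T)); rewrite setCK setC0 => ->.
by rewrite cardsT.
Qed.

(** A leaf of [F] restricted to [D] is a leaf of [F], for no edge of [F] leaves [D]; not being
    isolated, it has its neighbour in [D]. *)
Lemma closed_pendant (D : {set T}) : D != set0 ->
    (forall x y, x \in D -> y \notin D -> fr x y) ->
    (forall z, exists2 y, y != z & ~~ fr z y) ->
  exists l w, [/\ l \in D, w \in D & pendant fr l w].
Proof.
move=> D0 cD nodom.
have [||l lD [n fn]] := leaf (r := enum D); first exact: enum_uniq.
  by apply: contraNneq D0 => E; apply/eqP/setP=> x; rewrite inE -mem_enum E.
rewrite mem_enum in lD.
have fl y : y != l -> y != n -> fr l y.
  move=> yl yn; have [yD|yD] := boolP (y \in D); last exact: cD.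
  by apply: fn; rewrite ?mem_enum.
have [w wl lw] := nodom l.
have wn : w = n by apply: contraNeq lw => wn; apply: fl.
exists l, w; split=> //; first by apply: contraNT lw => /(cD _ _ lD).
by split; [rewrite eq_sym|rewrite wn].
Qed.

Lemma reach_theta u v (P : 'I_3 -> seq T) s t :
  theta eX u v P -> 1 < #|T| -> reach eX fr s t.
Proof.
move=> th T1; have [[c [cc uc call]]|P0] := theta_hamiltonian th.
  exact: (reach_hamiltonian frC leaf coprime_closed _ _ cc).
have [z /forallP dom|nodom] :=
    pickP (fun z => [forall y, (y != z) ==> fr z y]).
  apply: (reach_dominant eXC frC th leaf (z := z)) => y.
  exact/implyP.
have {}nodom z : exists2 y, y != z & ~~ fr z y.
  have /negbT := nodom z; rewrite negb_forall => /existsP[y].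
  by rewrite negb_imply => /andP[yz zy]; exists y.
have [D [cD D0 DC0]] := exists_closed T1.
have cDC x y : x \in ~: D -> y \notin ~: D -> fr x y.
  by rewrite !inE negbK frC => xD yD; apply: cD.
(* One leaf inside [D] and one outside, each on the same side as its neighbour: the four people are
   distinct. *)
have [l1 [w1 [l1D w1D lw1]]] := closed_pendant D0 cD nodom.
have [l2 [w2 [l2D w2D lw2]]] := closed_pendant DC0 cDC nodom.
rewrite !inE in l2D w2D.
apply: (@reach_two_leaves T eX fr eXC frC u v P th leaf P0
  (fun b => if b then l1 else l2) (fun b => if b then w1 else w2) _ _ D) => //.
  by case.
have neq x y : x \in D -> y \notin D -> x != y.
  by move=> xD; apply: contraNneq => <-.
rewrite /= !inE !negb_or (neq l1 l2) // (neq l1 w2) // (neq w1 w2) //.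
by rewrite (proj1 lw1) (proj1 lw2) eq_sym neq.
Qed.

End Abstract.

(** * From the graphs to the puzzle *)

Lemma forest_leaf (G : sgraph) (r : seq G) : forest G -> r != [::] ->
  exists2 l, l \in r &
    exists n, {in r, forall y, y != l -> y != n -> ~~ edge l y}.
Proof.
move=> forG; case: r => // x0 r0 _; set r := x0 :: r0.
(* A path inside [r] is prolonged at its head [x] as long as possible; [m] is the fuel. *)
suff ext m x p : size r - size p <= m -> path (@edge G) x p -> uniq (x :: p) ->
    {subset x :: p <= r} -> exists2 l, l \in r &
    exists n, {in r, forall y, y != l -> y != n -> ~~ edge l y}.
  apply: (ext (size r) x0 [::]) => //.
  by move=> z; rewrite inE => /eqP->; apply: mem_head.
elim: m x p => [|m IH] x p sz pp up sub.
  by have := uniq_leq_size up sub; rewrite ltnNge -subn_eq0 -leqn0 sz.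
have [/hasP[z zr /andP[zp xz]]|nz] :=
    boolP (has (fun z => (z \notin x :: p) && edge x z) r).
  apply: (IH z (x :: p)).
  - by rewrite /= subnS; case: (size r - size p) sz.
  - by rewrite /= edge_sym xz.
  - by rewrite cons_uniq zp.
  by move=> y; rewrite inE => /orP[/eqP->//|/sub].
(* A path that cannot be prolonged at [x]: a second neighbour of [x] would
   close a cycle. *)
exists x; first by apply: sub; apply: mem_head.
(* The default [x] is for the path of one vertex, where [x] has no neighbour in [r] at all. *)
exists (head x p) => y yr yx yn; apply/negP=> xy.
have : y \in p.
  move/hasPn: nz => /(_ y yr); rewrite xy andbT negbK inE (negPf yx).
  by [].
case: p => // n p in pp up sub yn {sz nz} *; rewrite inE (negPf yn) /= => yp.
case/splitPr: yp => p1 p2 in pp up sub.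
move/negP: (forG (x :: n :: rcons p1 y)); apply; apply/and3P; split.
- by rewrite /= size_rcons.
- move: pp; rewrite /= -cat_rcons cat_path => /and3P[-> pp _] /=.
  by rewrite rcons_path pp last_rcons edge_sym.
move: up; rewrite -cat_rcons -2!cat_cons cat_uniq.
by case/and3P.
Qed.

(** A decomposition covers the edges, so a vertex is known to be covered once it has a neighbour. *)
Lemma ear_decomposition_cover (G : sgraph) (c : seq G) ears x y :
  open_ear_decomposition c ears -> edge x y -> x \in c ++ flatten ears.
Proof.
case=> _ _ _ cov xy.
have : [set x; y] \in edge_set G by apply/imsetP; exists (x, y); rewrite ?inE.
have from_zip (s t : seq G) : [set x; y] \in
    [set [set u.1; u.2] | u in zip s t] -> (x \in s) || (x \in t).
  case/imsetP=> u /mem_zip/andP[u1 u2] /setP/(_ x).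
  by rewrite !inE eqxx /= => /esym/orP[]/eqP->; rewrite ?u1 ?u2 ?orbT.
rewrite -cov => /mem_bigcup_seq[E]; rewrite inE mem_cat.
case/orP=> [/eqP->|/mapP[p pe ->]] /from_zip.
  by rewrite mem_rot orbb => ->.
move=> xp; apply/orP; right; apply/flattenP; exists p => //.
by case/orP: xp => // /mem_behead.
Qed.

(** Without ears the cycle is Hamiltonian. The ends of a single ear cut the cycle into two paths,
    and the ear is the third. *)
Lemma ear_decomposition_theta (G : sgraph) (c : seq G) ears :
    open_ear_decomposition c ears -> size ears <= 1 ->
    (forall x : G, exists y, edge x y) ->
  [/\ path.cycle (@edge G) c, uniq c & forall x, x \in c] \/
  exists u v P, theta (@edge G) u v P.
Proof.
move=> dec ears1 nbr.
have cov x : x \in c ++ flatten ears.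
  by have [y] := nbr x; apply: ear_decomposition_cover dec.
case: dec => /and3P[_ cc uc] ear _ _.
case: ears ears1 ear cov => [|p []] // _ ear cov.
  by left; split=> // x; have := cov x; rewrite cats0.
right; have {}cov x : (x \in c) || (x \in p).
  by have := cov x; rewrite /= cats0 mem_cat.
move: (ear 0 isT) => {ear}; rewrite /= cats0; case: p cov => //= x q cov.
case/and5P=> pq xq q0 xc /andP[].
case/lastP: q q0 pq xq cov => // q y _ pq xq cov.
rewrite last_rcons belast_rcons /= => yc /allP qc.
have [i c' Ei] := rot_to xc; have mc z : (z \in x :: c') = (z \in c).
  by rewrite -Ei mem_rot.
have {}uc : uniq (x :: c') by rewrite -Ei rot_uniq.
have {}cc : path.cycle (@edge G) (x :: c') by rewrite -Ei rot_cycle.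
have xy : x != y by move: xq; rewrite mem_rcons inE negb_or => /andP[/andP[]].
have yc' : y \in c' by move: yc; rewrite -mc inE eq_sym (negPf xy).
case/splitPr: yc' => A B in Ei mc uc cc.
have [uA uy uB] : [/\ uniq (x :: rcons A y), uniq (y :: rcons B x) &
    {in A, forall z, z \notin B}].
  move: uc; rewrite /= mem_cat inE !negb_or cat_uniq /= negb_or.
  case/and5P=> /and3P[xA _ xB] uA /andP[yA /hasPn AB] yB uB.
  rewrite !rcons_uniq !mem_rcons !inE !negb_or xA yA xB yB uA uB xy eq_sym xy.
  by split=> // z zA; apply/negP => /AB/negP; apply.
have [pA pB] : path (@edge G) x (rcons A y) /\ path (@edge G) y (rcons B x).
  move: cc; rewrite /= rcons_cat rcons_cons -cat_rcons cat_path last_rcons.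
  by case/andP.
have qc' z : z \in q -> z \notin x :: A ++ y :: B by rewrite mc; apply: qc.
(* Along the cycle [B] leads from [y] back to [x], hence [rev B]. *)
exists x, y, (fun k : 'I_3 => nth [::] [:: A; rev B; q] k).
split.
- case=> [[|[|[|//]]] _] //=.
  by rewrite -cons_uniq -rev_uniq rev_cons rev_rcons revK; move: uy.
- case=> [[|[|[|//]]] _] //=.
  rewrite -rev_cons -(belast_rcons y _ x) -{1}(last_rcons y B x) rev_path.
  by rewrite (eq_path (e' := @edge G)) // => a b; apply: edge_sym.
- move=> [[|[|[|//]]] i1] [[|[|[|//]]] j1] z /=; rewrite ?mem_rev => zi zj;
    apply: val_inj => //=.
  + by have := uB z zi; rewrite zj.
  + by have := qc' z zj; rewrite inE mem_cat zi orbT.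
  + by have := uB z zj; rewrite zi.
  + by have := qc' z zj; rewrite !(inE, mem_cat) zi !orbT.
  + by have := qc' z zi; rewrite inE mem_cat zj orbT.
  + by have := qc' z zi; rewrite !(inE, mem_cat) zj !orbT.
move=> z; rewrite !inE negb_or => /andP[zx zy]; have := cov z.
rewrite -mc !(inE, mem_cat, mem_rcons) (negPf zx) (negPf zy) /=.
case/orP=> [/orP[zA|zB]|zq].
- by exists ord0.
- by exists (Ordinal (isT : 1 < 3)); rewrite /= mem_rev.
by exists ord_max.
Qed.

(** * Permutations of [X] as vertices of [FS X Y] *)

Section Transport.

Variables (X Y : sgraph) (g : X -> Y) (h : Y -> X).
Hypotheses (gK : cancel g h) (hK : cancel h g).

Definition friends : rel X := fun x y => edge (g x) (g y).

Definition state_fun (s : {perm X}) := [ffun x => g (s x)].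

Lemma state_proof s :
  injectiveb (state_fun s) && [forall y, y \in codom (state_fun s)].
Proof.
apply/andP; split.
  by apply/injectiveP=> x y; rewrite !ffunE => /(can_inj gK)/perm_inj.
apply/forallP=> y; apply/codomP; exists (s^-1 (h y))%g.
by rewrite ffunE permKV hK.
Qed.

Definition state s : FS_vertex X Y := exist _ (state_fun s) (state_proof s).

Lemma state_surj (f : FS_vertex X Y) : exists s, f = state s.
Proof.
have /andP[/injectiveP f_inj _] := valP f.
have hf_inj : injective (fun x => h (val f x)).
  by move=> x y /(can_inj hK)/f_inj.
exists (perm hf_inj); apply: val_inj; apply/ffunP=> x.
by rewrite /= ffunE permE hK.
Qed.

Lemma state_reach s t : reach (@edge X) friends s t ->
  connect (@edge (FS X Y)) (state s) (state t).
Proof.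
case/connectP=> p; elim: p s => [|r p IH] s /=; first by move=> _ ->.
case/andP=> /existsP[a /existsP[b /and3P[ab sab /eqP Er]]] pp Et.
apply: connect_trans (IH _ pp Et); apply: connect1.
apply/existsP; exists a; apply/existsP; exists b.
rewrite /= !ffunE Er !permM tpermL tpermR !eqxx; apply/and5P; split=> //.
apply/forallP=> c; apply/implyP=> /andP[ca cb].
by rewrite !ffunE permM tpermD // eq_sym.
Qed.

Lemma friends_leaf : forest (compl Y) ->
  forall r : seq X, uniq r -> r != [::] ->
  exists2 l, l \in r &
    exists n, {in r, forall y, y != l -> y != n -> friends l y}.
Proof.
move=> forY r _ r0.
have [|l lr [n fn]] := @forest_leaf (compl Y) (map g r) forY.
  by case: (r) r0.
exists (h l); first by case/mapP: lr => x xr ->; rewrite gK.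
exists (h n) => y yr yl yn.
have gy z : y != h z -> g y != z by apply: contraNneq => <-; rewrite gK.
have := fn (g y) (map_f g yr) (gy _ yl) (gy _ yn).
by rewrite /= /compl_edge eq_sym gy //= negbK /friends hK.
Qed.

(** No edge of the complement of [Y] leaves a component, so [d] divides the size of the preimage of
    each component, and hence the gcd. *)
Lemma friends_coprime :
    \big[gcdn/0]_(C in components (compl Y)) #|C| = 1 ->
  forall d, (forall D : {set X},
      (forall x y, x \in D -> y \notin D -> friends x y) -> d %| #|D|) -> d = 1.
Proof.
move=> gcdY d dD; apply/eqP; rewrite -dvdn1 -gcdY.
elim/big_rec: _ => [|C m /imsetP[x0 _ EC] dm]; first exact: dvdn0.
rewrite dvdn_gcd dm andbT.
have -> : #|C| = #|g @^-1: C|.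
  by rewrite on_card_preimset //; exists h => y _; [apply: gK|apply: hK].
apply: dD => x y; rewrite !inE EC !inE /= => x0x x0y.
apply: contraNT (x0y) => gxy; apply: connect_trans (x0x) (connect1 _).
by apply/andP; split=> //; apply: contraNneq x0y => <-.
Qed.

End Transport.

Lemma eq_card_bij (A B : finType) : #|A| = #|B| ->
  exists (g : A -> B) (h : B -> A), cancel g h /\ cancel h g.
Proof.
move=> E; exists (fun x => enum_val (cast_ord E (enum_rank x))).
exists (fun y => enum_val (cast_ord (esym E) (enum_rank y))).
by split=> z; rewrite enum_valK ?cast_ordK ?cast_ordKV enum_rankK.
Qed.

Lemma connected_neighbour (G : sgraph) : 1 < #|G| -> connected G ->
  forall x : G, exists y, edge x y.
Proof.
move=> G1 [_ conn] x; have : 0 < #|predC1 x| by rewrite cardC1 -subn1 subn_gt0.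
case/card_gt0P=> y; rewrite inE => yx.
case/connectP: (conn x y) => -[_ E|z p /andP[xz _] _]; last by exists z.
by rewrite E eqxx in yx.
Qed.

Theorem theorem3p14 (n : nat) (X Y : sgraph)
    (n_ge3 : 3 <= n) (cardX : #|X| = n) (cardY : #|Y| = n)
    (biconnX : biconnected X)
    (earX : exists (c : seq X) (ears : seq (seq X)),
        open_ear_decomposition c ears /\ size ears <= 1)
    (forestY : forest (compl Y))
    (gcdY : \big[gcdn/0]_(T in components (compl Y)) #|T| = 1) :
  connected (FS X Y).
Proof.
have X1 : 1 < #|X| by rewrite cardX ltnW.
have [g [h [gK hK]]] := eq_card_bij (etrans cardX (esym cardY)).
have frC : symmetric (friends g) by move=> x y; apply: edge_sym.
have leaf := friends_leaf gK hK forestY.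
have cop := friends_coprime gK hK gcdY.
split; first by apply/card_gt0P; exists (state gK hK 1%g).
move=> f1 f2; have [s1 ->] := state_surj gK hK f1.
have [s2 ->] := state_surj gK hK f2; apply: state_reach.
have [c [ears [dec ears1]]] := earX.
(* A neighbour at every vertex ensures that the cycle and the ear pass through all of [X]. *)
have nbr := connected_neighbour X1 (proj1 biconnX).
have [[cc uc call]|[u [v [P th]]]] := ear_decomposition_theta dec ears1 nbr.
  exact: (reach_hamiltonian frC leaf cop _ _ cc).
exact: (reach_theta (@edge_sym X) frC leaf cop _ _ th X1).
Qed.
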